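(* Let $n\geqslant 4$, let $B=\{a_0,b_0,e_1,c,d,z_1\}$ and let $\bar R$ be the following set of relations on the alphabet $B$: $(R_1)$ $a_0^2=1$; $(R_2)$ $b_0^{n-1}=1$; $(R_3)$ $(b_0a_0)^{n-2}=1$; $(R_4)$ $(a_0b_0^{n-2}a_0b_0)^3=1$; $(R_5)$ $(a_0b_0^{n-1-j}a_0b_0^j)^2=1$ for $j=2,\ldots,n-3$; $(R_6)$ $e_1^2=e_1$ and $d^2=d$; $(R_7)$ $a_0e_1=e_1a_0$, $da_0=a_0d$, $db_0=b_0d$ and $de_1=e_1d$; $(R_8)$ $b_0a_0b_0^{n-2}e_1b_0a_0b_0^{n-2}=b_0^{n-2}e_1b_0$; $(R_9)$ $(b_0^{n-2}e_1b_0a_0)^2=(a_0b_0^{n-2}e_1b_0)^2$; $(R_{10})$ $b_0^{n-2}e_1b_0a_0b_0^{n-2}e_1b_0=(a_0b_0^{n-2}e_1b_0)^2$; $(R_{11})$ $z_1^3=z_1$; $(R_{12})$ $z_1b_0=z_1a_0$; $(R_{13})$ $b_0^{n-2}z_1=a_0z_1$; $(R_{14})$ $a_0b_0^jz_1=b_0^jz_1$ for $j=1,\ldots,n-3$; $(R_{15})$ $e_1b_0z_1=z_1d$; $(R_{16})$ $e_1b_0^jz_1=b_0^jz_1$ for $j=2,\ldots,n-3$; $(R_{17})$ $(e_1b_0)^{n-3}e_1=z_1^2a_0b_0^{n-4}$; $(R_{18})$ $dz_1^2=z_1a_0z_1$; $(R_{19})$ $(dz_1)^2=dz_1d$; $(R_{20})$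 $cz_1=z_1^2d$; $(R_{21})$ $z_1c=z_1^2b_0^{n-2}e_1b_0$; $(R_{22})$ $ca_0z_1=a_0ca_0z_1^2$; $(R_{23})$ $ce_1=e_1c$; $(R_{24})$ $dc=c$ and $cb_0^{n-2}e_1b_0=c$; $(R_{25})$ $cd=c^2$ and $db_0^{n-2}e_1b_0=c^2$; $(R_{26})$ $cb_0a_0=b_0a_0c$ and $cb_0^{n-2}a_0b_0=b_0^{n-2}a_0b_0c$. Then the presentation $\langle B\mid\bar R\rangle$ defines the monoid $\mathrm{IEnd}(S_n)$ of all injective partial endomorphisms of the star graph $S_n$.
   Context: Let $\Omega_{n-1}=\{1,\ldots,n-1\}$ and $\Omega_{n-1}^0=\{0,1,\ldots,n-1\}$. Partial maps are written on the right and composed from left to right. $S_n$ is the star graph with vertex set $\Omega_{n-1}^0$ and edge set $\{\{0,i\}\mid 1\leqslant i\leqslant n-1\}$. For a simple graph $G=(V,E)$, a partial transformation $\alpha$ of $V$ is a partial endomorphism if, for all $u,v\in\mathrm{Dom}(\alpha)$, $\{u,v\}\in E$ implies $\{u\alpha,v\alpha\}\in E$; $\mathrm{IEnd}(G)$ is the monoid of all injective partial endomorphisms of $G$. The letters stand for the following generators of $\mathrm{IEnd}(S_n)$: $a_0$ is the permutation of $\Omega_{n-1}^0$ swapping $1$ and $2$ and fixing all else; $b_0$ is the permutation with $0\mapsto 0$, $i\mapsto i+1$ for $1\leqslant i\leqslant n-2$, $n-1\mapsto 1$; $e_1$ is the partial identity with domain $\{0,1,\ldots,n-2\}$; $c$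 has domain $\Omega_{n-1}$, with $1\mapsto 0$ and $i\mapsto i$ for $2\leqslant i\leqslant n-1$; $d$ is the partial identity with domain $\Omega_{n-1}$; $z_1$ has domain $\{0,1\}$, with $0\mapsto 1$ and $1\mapsto 0$. For an alphabet $X$, $X^*$ is the free monoid on $X$ (with empty word $1$); a relation $u=v$ is a pair $(u,v)\in X^*\times X^*$; $\sim_R$ is the congruence on $X^*$ generated by $R$. A monoid $M$ is defined by the presentation $\langle X\mid R\rangle$ if $M\cong X^*/{\sim_R}$. *)

(* Defs.v *)
From HB Require Import structures.
From mathcomp Require Import all_boot.
From mathcomp Require Import generic_quotient boolp.

Set Implicit Arguments.
Unset Strict Implicit.
Unset Printing Implicit Defensive.

Local Open Scope quotient_scope.
Local Open Scope group_scope.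

Definition word (X : Type) := seq X.

HB.instance Definition _ (X : choiceType) := Choice.on (word X).

Definition wcat {X : Type} (u v : word X) : word X := u ++ v.
Definition wnil {X : Type} : word X := [::].

Lemma wcatA {X : Type} : associative (@wcat X).
Proof. exact: catA. Qed.
Lemma wcat1w {X : Type} : left_id wnil (@wcat X).
Proof. by []. Qed.
Lemma wcatw1 {X : Type} : right_id wnil (@wcat X).
Proof. exact: cats0. Qed.

HB.instance Definition _ (X : choiceType) :=
  isMonoid.Build (word X) wcatA wcat1w wcatw1.

Definition letter (X : Type) (x : X) : word X := [:: x].

Section Presentation.

Variables (X : choiceType) (R : word X -> word X -> Prop).

Inductive cong : word X -> word X -> Prop :=
| cong_base u v : R u v -> cong u v
| cong_refl u : cong u u
| cong_sym u v : cong u v -> cong v u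
| cong_trans u v w : cong u v -> cong v w -> cong u w
| cong_mul u v u' v' : cong u v -> cong u' v' -> cong (u * u') (v * v').

Definition congb : rel (word X) := fun u v => `[< cong u v >].

Lemma congb_refl : reflexive congb.
Proof. by move=> u; apply/asboolP/cong_refl. Qed.

Lemma congb_sym : symmetric congb.
Proof. by move=> u v; apply/asboolP/asboolP; apply: cong_sym. Qed.

Lemma congb_trans : transitive congb.
Proof.
by move=> v u w /asboolP uv /asboolP vw; apply/asboolP/(cong_trans uv vw).
Qed.

Canonical congb_equiv := EquivRel congb congb_refl congb_sym congb_trans.

Definition quot_monoid := {eq_quot congb}.

HB.instance Definition _ := Choice.on quot_monoid.
HB.instance Definition _ := EqQuotient.on quot_monoid.

Definition wclass (u : word X) : quot_monoid := \pi_quot_monoid u.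

Lemma wclassP u v : wclass u = wclass v <-> cong u v.
Proof.
rewrite /wclass; split=> [/eqP|uv]; last by apply/eqP; rewrite piE; apply/asboolP.
by rewrite piE => /asboolP.
Qed.

Lemma reprK_wclass (x : quot_monoid) : wclass (repr x) = x.
Proof. exact: reprK. Qed.

Definition qmul (x y : quot_monoid) : quot_monoid := wclass (repr x * repr y).
Definition qone : quot_monoid := wclass 1.

Lemma wclassM u v : wclass (u * v) = qmul (wclass u) (wclass v).
Proof.
by apply/wclassP/cong_mul; apply/wclassP; rewrite reprK_wclass.
Qed.

Lemma qmulA : associative qmul.
Proof.
move=> x y z; rewrite -[x]reprK_wclass -[y]reprK_wclass -[z]reprK_wclass.
by rewrite -!wclassM mulgA.
Qed.

Lemma qmul1q : left_id qone qmul.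
Proof.
by move=> x; rewrite -[x]reprK_wclass /qone -wclassM mul1g.
Qed.

Lemma qmulq1 : right_id qone qmul.
Proof.
by move=> x; rewrite -[x]reprK_wclass /qone -wclassM mulg1.
Qed.

HB.instance Definition _ := isMonoid.Build quot_monoid qmulA qmul1q qmulq1.

(* [g] records which element of [M] each letter stands for; the isomorphism
   is required to send the class of a letter to that element. *)
Definition defines (M : monoidType) (g : X -> M) : Prop :=
  exists phi : quot_monoid -> M,
    [/\ monoid_morphism phi, bijective phi
      & forall x : X, phi (wclass (letter x)) = g x].

End Presentation.

Section PartialTransformations.

Variable V : finType.

Definition ptrans := {ffun V -> option V}.

HB.instance Definition _ := Finite.on ptrans.

(* [alpha v = None] means that [v] is not in the domain of [alpha]; products
   are composed from left to right. *)
Definition ptmul (alpha beta : ptrans) : ptrans :=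
  [ffun v => obind beta (alpha v)].
Definition ptone : ptrans := [ffun v => Some v].

Lemma ptmulA : associative ptmul.
Proof.
move=> f g h; apply/ffunP => v; rewrite !ffunE.
by case: (f v) => //= w; rewrite ffunE.
Qed.

Lemma ptmul1p : left_id ptone ptmul.
Proof. by move=> f; apply/ffunP => v; rewrite !ffunE. Qed.

Lemma ptmulp1 : right_id ptone ptmul.
Proof.
by move=> f; apply/ffunP => v; rewrite ffunE; case: (f v) => //= w; rewrite ffunE.
Qed.

HB.instance Definition _ := isMonoid.Build ptrans ptmulA ptmul1p ptmulp1.

Definition pinjective (alpha : ptrans) : Prop :=
  forall u v w, alpha u = Some w -> alpha v = Some w -> u = v.

End PartialTransformations.

Record sgraph := SGraph {
  vertex :> finType;
  edge : rel vertex;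
  edge_sym : symmetric edge;
  edge_irr : irreflexive edge }.
Arguments edge {s}.

Section IEnd.

Variable G : sgraph.

Definition partial_endo (alpha : ptrans G) : Prop :=
  forall u v u' v', alpha u = Some u' -> alpha v = Some v' ->
    edge u v -> edge u' v'.

Definition is_iend : pred (ptrans G) :=
  fun alpha => `[< pinjective alpha /\ partial_endo alpha >].

Lemma is_iendP alpha :
  reflect (pinjective alpha /\ partial_endo alpha) (is_iend alpha).
Proof. exact: asboolP. Qed.

Lemma is_iend_closed : monoid_closed is_iend.
Proof.
split=> [|f g /is_iendP[fi fe] /is_iendP[gi ge]]; apply/is_iendP; split.
- by move=> u v w; rewrite !ffunE => -[->] [->].
- by move=> u v u' v'; rewrite !ffunE => -[->] [->].
- move=> u v w; rewrite !ffunE.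
  case Eu: (f u) => [u1|] //= gu; case Ev: (f v) => [v1|] //= gv.
  by apply: (fi _ _ u1) => //; rewrite (gi _ _ _ gu gv).
- move=> u v u' v'; rewrite !ffunE.
  case Eu: (f u) => [u1|] //= gu; case Ev: (f v) => [v1|] //= gv uv.
  exact: ge gu gv (fe _ _ _ _ Eu Ev uv).
Qed.

Record iend := IEnd { iend_val :> ptrans G; iendP : is_iend iend_val }.

HB.instance Definition _ := [isSub for iend_val].
HB.instance Definition _ := [Finite of iend by <:].
HB.instance Definition _ :=
  SubChoice_isSubMonoid.Build (ptrans G) is_iend iend is_iend_closed.

End IEnd.

Section Star.

Local Open Scope nat_scope.

Variable n : nat.

Definition star_edge : rel 'I_n :=
  fun u v => ((u == 0 :> nat) && (0 < v)) || ((v == 0 :> nat) && (0 < u)).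

Lemma star_edge_sym : symmetric star_edge.
Proof. by move=> u v; rewrite /star_edge orbC. Qed.

Lemma star_edge_irr : irreflexive star_edge.
Proof. by move=> u; rewrite /star_edge orbb; case: (nat_of_ord u). Qed.

Definition star : sgraph := SGraph star_edge_sym star_edge_irr.

(* The partial map of [{0, ..., n - 1}] given by [f], undefined where the
   value of [f] is [None] or at least [n]. *)
Definition ptrans_of (f : nat -> option nat) : ptrans star :=
  [ffun i : 'I_n => obind insub (f i)].

Definition fun_a0 (i : nat) : option nat :=
  Some (if i == 1 then 2 else if i == 2 then 1 else i).
Definition fun_b0 (i : nat) : option nat :=
  Some (if i == 0 then 0 else if i == n - 1 then 1 else i.+1).
Definition fun_e1 (i : nat) : option nat :=
  if i <= n - 2 then Some i else None.
Definition fun_c (i : nat) : option nat :=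
  if i == 0 then None else if i == 1 then Some 0 else Some i.
Definition fun_d (i : nat) : option nat :=
  if i == 0 then None else Some i.
Definition fun_z1 (i : nat) : option nat :=
  if i == 0 then Some 1 else if i == 1 then Some 0 else None.

Definition inj_on_dom (f : nat -> option nat) : Prop :=
  forall i j k, i < n -> j < n -> f i = Some k -> f j = Some k -> i = j.

Definition star_hom (f : nat -> option nat) : Prop :=
  forall i i' k, 0 < i -> f 0 = Some k -> f i = Some i' ->
  (k == 0) && (0 < i') || (i' == 0) && (0 < k).

Lemma ptrans_ofP f (i k : 'I_n) :
  ptrans_of f i = Some k -> f i = Some (k : nat).
Proof.
rewrite ffunE; case: (f i) => //= m; case: insubP => //= k' _ <- [<-] //.
Qed.

Lemma ptrans_of_iend f :
  inj_on_dom f -> star_hom f -> is_iend (ptrans_of f).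
Proof.
move=> fi fe; apply/is_iendP; split=> [u v w|u v u' v'].
  move=> /ptrans_ofP fu /ptrans_ofP fv.
  by apply: val_inj; apply: (fi _ _ w) => //; apply: ltn_ord.
move=> /ptrans_ofP fu /ptrans_ofP fv /orP[]/andP[/eqP x0 y0].
- by rewrite x0 in fu; apply: fe y0 fu fv.
- by rewrite x0 in fv; have := fe _ _ _ y0 fv fu; rewrite orbC.
Qed.

Lemma a0_iend : is_iend (ptrans_of fun_a0).
Proof.
apply: ptrans_of_iend => [i j k _ _ [<-] []|i i' k i0 [<-] [<-]].
  by case: i => [|[|[|i]]]; case: j => [|[|[|j]]] //= [].
by case: i i0 => [|[|[|i]]].
Qed.

Lemma b0_iend : is_iend (ptrans_of fun_b0).
Proof.
apply: ptrans_of_iend => [i j k ltin ltjn [<-] []|i i' k i0 [<-] [<-]].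
  case: i j ltin ltjn => [|i] [|j] //= _ _; do ?by case: ifP.
  by case: eqP => [->|_]; case: eqP => [->|_] // [] ->.
by case: i i0 => //= i _; case: ifP.
Qed.

Lemma e1_iend : is_iend (ptrans_of fun_e1).
Proof.
rewrite /fun_e1; apply: ptrans_of_iend => [i j k _ _|i i' k i0 [<-]].
  by case: ifP => // _; case: ifP => // _ [->] [].
by case: ifP => // _ [<-]; rewrite i0.
Qed.

Lemma c_iend : is_iend (ptrans_of fun_c).
Proof.
apply: ptrans_of_iend => [i j k _ _|//].
by case: i j => [|[|i]] [|[|j]] //= [<-] // [->].
Qed.

Lemma d_iend : is_iend (ptrans_of fun_d).
Proof.
apply: ptrans_of_iend => [i j k _ _|//].
by case: i j => [|i] [|j] //= [<-] // [->].
Qed.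

Lemma z1_iend : is_iend (ptrans_of fun_z1).
Proof.
apply: ptrans_of_iend => [i j k _ _|i i' k].
  by case: i j => [|[|i]] [|[|j]] //= [<-] //.
by case: i => [|[|i]] //= _ [<-] [<-].
Qed.

End Star.

Inductive alphabet := La0 | Lb0 | Le1 | Lc | Ld | Lz1.

Definition alphabet_code (x : alphabet) : nat :=
  match x with La0 => 0 | Lb0 => 1 | Le1 => 2 | Lc => 3 | Ld => 4 | Lz1 => 5 end.
Definition alphabet_decode (k : nat) : alphabet :=
  nth La0 [:: La0; Lb0; Le1; Lc; Ld; Lz1] k.
Lemma alphabet_codeK : cancel alphabet_code alphabet_decode.
Proof. by case. Qed.

HB.instance Definition _ := Choice.copy alphabet (can_type alphabet_codeK).

Definition generator (n : nat) (x : alphabet) : iend (star n) :=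
  match x with
  | La0 => IEnd (a0_iend n)
  | Lb0 => IEnd (b0_iend n)
  | Le1 => IEnd (e1_iend n)
  | Lc => IEnd (c_iend n)
  | Ld => IEnd (d_iend n)
  | Lz1 => IEnd (z1_iend n)
  end.

Local Notation a0 := (letter La0).
Local Notation b0 := (letter Lb0).
Local Notation e1 := (letter Le1).
Local Notation c := (letter Lc).
Local Notation d := (letter Ld).
Local Notation z1 := (letter Lz1).

Inductive Rbar (n : nat) : word alphabet -> word alphabet -> Prop :=
| R1 : Rbar n (a0 ^+ 2) 1
| R2 : Rbar n (b0 ^+ (n - 1)) 1
| R3 : Rbar n ((b0 * a0) ^+ (n - 2)) 1
| R4 : Rbar n ((a0 * b0 ^+ (n - 2) * a0 * b0) ^+ 3) 1
| R5 (j : nat) : 2 <= j <= n - 3 ->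
    Rbar n ((a0 * b0 ^+ (n - 1 - j) * a0 * b0 ^+ j) ^+ 2) 1
| R6_e1 : Rbar n (e1 ^+ 2) e1
| R6_d : Rbar n (d ^+ 2) d
| R7_a0e1 : Rbar n (a0 * e1) (e1 * a0)
| R7_da0 : Rbar n (d * a0) (a0 * d)
| R7_db0 : Rbar n (d * b0) (b0 * d)
| R7_de1 : Rbar n (d * e1) (e1 * d)
| R8 : Rbar n (b0 * a0 * b0 ^+ (n - 2) * e1 * b0 * a0 * b0 ^+ (n - 2))
              (b0 ^+ (n - 2) * e1 * b0)
| R9 : Rbar n ((b0 ^+ (n - 2) * e1 * b0 * a0) ^+ 2)
              ((a0 * b0 ^+ (n - 2) * e1 * b0) ^+ 2)
| R10 : Rbar n (b0 ^+ (n - 2) * e1 * b0 * a0 * b0 ^+ (n - 2) * e1 * b0)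
               ((a0 * b0 ^+ (n - 2) * e1 * b0) ^+ 2)
| R11 : Rbar n (z1 ^+ 3) z1
| R12 : Rbar n (z1 * b0) (z1 * a0)
| R13 : Rbar n (b0 ^+ (n - 2) * z1) (a0 * z1)
| R14 (j : nat) : 1 <= j <= n - 3 ->
    Rbar n (a0 * b0 ^+ j * z1) (b0 ^+ j * z1)
| R15 : Rbar n (e1 * b0 * z1) (z1 * d)
| R16 (j : nat) : 2 <= j <= n - 3 ->
    Rbar n (e1 * b0 ^+ j * z1) (b0 ^+ j * z1)
| R17 : Rbar n ((e1 * b0) ^+ (n - 3) * e1) (z1 ^+ 2 * a0 * b0 ^+ (n - 4))
| R18 : Rbar n (d * z1 ^+ 2) (z1 * a0 * z1)
| R19 : Rbar n ((d * z1) ^+ 2) (d * z1 * d)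
| R20 : Rbar n (c * z1) (z1 ^+ 2 * d)
| R21 : Rbar n (z1 * c) (z1 ^+ 2 * b0 ^+ (n - 2) * e1 * b0)
| R22 : Rbar n (c * a0 * z1) (a0 * c * a0 * z1 ^+ 2)
| R23 : Rbar n (c * e1) (e1 * c)
| R24_dc : Rbar n (d * c) c
| R24_ce : Rbar n (c * b0 ^+ (n - 2) * e1 * b0) c
| R25_cd : Rbar n (c * d) (c ^+ 2)
| R25_de : Rbar n (d * b0 ^+ (n - 2) * e1 * b0) (c ^+ 2)
| R26_ba : Rbar n (c * b0 * a0) (b0 * a0 * c)
| R26_bab : Rbar n (c * b0 ^+ (n - 2) * a0 * b0)
                   (b0 ^+ (n - 2) * a0 * b0 * c).

(* Main.v *)
Require Import Defs.
From mathcomp Require Import all_boot all_fingroup boolp zify.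

(* Relations R1-R5 are Moore's presentation of the symmetric group on the leaves,
   which is reduced to Coxeter's: in any monoid satisfying the Coxeter relations,
   a word in the first k + 1 generators can be rewritten as a word in the first k
   followed by a descending run, and the run is determined by the image of the
   last point.  Hence in a monoid M generated subject to R1-R26 the symmetric group
   maps to M.  The conjugates of e_1 are commuting idempotents, and together with
   the permutations they satisfy the usual relations of the symmetric inverse
   monoid.  Multiplying by generators on the right, one then shows that each word
   equals a word of one of five shapes, according to whether the centre is fixed,
   sent to a leaf or undefined, and whether some leaf is sent to the centre.
   Two words of these shapes with the same action are equal in M by the relations
   of the symmetric inverse monoid alone, and every injective partial endomorphism
   of the star is the action of such a word. *)

Set Implicit Arguments.
Unset Strict Implicit.
Unset Printing Implicit Defensive.

Local Open Scope group_scope.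

(** Induction on the number of moved points: if [s] moves [x], then [s * tperm (s x) x] fixes [x]
    and every point that [s] fixes, and both [x] and [s x] lie in [D]. *)
Lemma tperm_ind (T : finType) (D : pred T) (P : {perm T} -> Prop) :
  P 1 ->
  (forall (s : {perm T}) x y, D x -> D y -> x != y -> P s -> P (s * tperm x y)) ->
  forall s : {perm T}, (forall x, ~~ D x -> s x = x) -> P s.
Proof.
move=> P1 PM s; have [m] := ubnP #|[pred x | s x != x]|.
elim: m s => // m IHm s le_m fixs.
have [/existsP[x sx]|/existsPn fix_s] := boolP [exists x, s x != x]; last first.
  by rewrite (_ : s = 1) //; apply/permP => x; rewrite perm1; apply/eqP/negPn.
have Dx : D x by apply: contraNT sx => /fixs->.
have Dsx : D (s x) by apply: contraNT sx => /fixs/perm_inj->.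
rewrite -[s]mulg1 -(tperm2 (s x) x) mulgA; apply: PM => //.
set s' := s * _.
have fixs' y : s y = y -> s' y = y.
  rewrite permM => sy; rewrite sy tpermD //; last by apply: contraNneq sx => ->; rewrite sy.
  by apply: contraNneq sx => sxy; apply/eqP/(@perm_inj _ s); rewrite sxy.
apply: IHm => [|y /fixs/fixs'//].
rewrite ltnS in le_m; apply: leq_trans le_m; apply: proper_card.
apply/properP; split; last by exists x; rewrite ?inE ?permM ?tpermL ?eqxx.
by apply/subsetP => y; rewrite !inE; apply: contraNN => /eqP/fixs'->.
Qed.

(** * Coxeter and Moore presentations of the symmetric group *)

Record coxeter (G : monoidType) (N : nat) (f : nat -> G) : Prop := Coxeter {
  coxeter_invol : forall i, i < N -> f i * f i = 1;
  coxeter_braid : forall i, i.+1 < N -> f i * f i.+1 * f i = f i.+1 * f i * f i.+1;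
  coxeter_comm : forall i j, i.+1 < j -> j < N -> f i * f j = f j * f i }.

(** For adjacent transpositions, the descending runs with [j + l] fixed represent the cosets of one
    symmetric group in the next. *)
Fixpoint desc (G : monoidType) (f : nat -> G) (j l : nat) : G :=
  if l is l'.+1 then f (j + l')%N * desc f j l' else 1.

Section Descending.

Variables (G : monoidType) (N : nat) (f : nat -> G).
Hypothesis cox_f : coxeter N f.

Lemma descSr j l : desc f j l.+1 = desc f j.+1 l * f j.
Proof.
elim: l => [|l IHl]; first by rewrite /= addn0 mulg1 mul1g.
by rewrite [LHS]/= -/(desc f j l.+1) IHl mulgA -addSnnS.
Qed.

Lemma desc_comm j l i : (i.+1 < j) || (j + l < i) -> i < N -> j + l <= N ->
  desc f j l * f i = f i * desc f j l.
Proof.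
move=> + iN; elim: l => [|l IHl] ij jl /=; first by rewrite mul1g mulg1.
rewrite -mulgA IHl; [|lia|lia]; rewrite !mulgA; congr (_ * _).
by case/orP: ij => ij; [symmetry|]; apply: (coxeter_comm cox_f); lia.
Qed.

(** The letter [f i.+1] commutes past the lower letters of the run, becomes [f i] by one braid move,
    and then commutes past the higher letters. *)
Lemma desc_braid j l i : j <= i -> i.+1 < j + l -> j + l <= N ->
  desc f j l * f i.+1 = f i * desc f j l.
Proof.
elim: l => [|l IHl] ji il jl; first lia.
rewrite /=; have [lt_i|ge_i] := ltnP i.+1 (j + l).
  rewrite -mulgA IHl //; last lia.
  by rewrite !mulgA (coxeter_comm cox_f (i := i)) //; lia.
have -> : (j + l = i.+1)%N by lia.
case: l {IHl} il jl ge_i => [|l] il jl ge_i; first lia.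
rewrite /=; have -> : (j + l = i)%N by lia.
rewrite -!mulgA desc_comm; [|lia|lia|lia].
by rewrite !mulgA (coxeter_braid cox_f) //; lia.
Qed.

End Descending.

(** * Adjacent transpositions as generators of the symmetric group *)

Section AdjacentTranspositions.

Variable N : nat.

Definition adj (i : nat) : 'S_N.+1 := tperm (inord i) (inord i.+1).

Lemma inord_eq i j : i <= N -> j <= N -> (inord i == inord j :> 'I_N.+1) = (i == j).
Proof. by move=> iN jN; rewrite -val_eqE /= !inordK. Qed.

(** Induction on the distance: the transposition of [i] and [j] is the conjugate of that of [i] and
    [j - 1] by [adj (j - 1)]. *)
Lemma adj_ind lo (P : 'S_N.+1 -> Prop) :
  (forall i, lo <= i -> i < N -> P (adj i)) ->
  (forall p q, P p -> P q -> P (p * q)) -> lo < N ->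
  forall p : 'S_N.+1, (forall i : 'I_N.+1, i < lo -> p i = i) -> P p.
Proof.
move=> Padj PM loN.
have Ptperm (i j : 'I_N.+1) : lo <= i -> i < j -> P (tperm i j).
  move=> lo_i ij; have [l ejl] : exists l, (j = i + l.+1 :> nat)%N by exists (j - i.+1)%N; lia.
  elim: l j ij ejl => [|l IHl] j ij ejl.
    rewrite (_ : tperm i j = adj i); first by apply: Padj => //; have := ltn_ord j; lia.
    by rewrite /adj inord_val -[j]inord_val ejl addn1.
  have jN := ltn_ord j; pose h := (i + l.+1)%N.
  have Ph : P (tperm i (inord h)) by apply: IHl; rewrite inordK; lia.
  have Pa : P (adj h) by apply: Padj; lia.
  rewrite (_ : tperm i j = adj h * tperm i (inord h) * adj h).
    by apply: (PM) => //; apply: (PM).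
  have -> : adj h * tperm i (inord h) * adj h = tperm i (inord h) ^ adj h.
    by rewrite /conjg /adj tpermV mulgA.
  have -> : j = inord h.+1 by apply: val_inj; rewrite /= inordK; lia.
  by rewrite /adj tpermJ tpermL tpermD //; rewrite -val_eqE /= inordK; lia.
move=> p fix_p; apply: (@tperm_ind _ (fun i : 'I_N.+1 => lo <= i)).
- by rewrite -(tperm2 (inord lo) (inord lo.+1)); apply: (PM); apply: Padj.
- move=> {fix_p}p i j lo_i lo_j i_j Pp; apply: PM => //.
  have [ij|ji|/val_inj/eqP eq_ij] := ltngtP i j; first exact: Ptperm.
    by rewrite tpermC; apply: Ptperm.
  by rewrite eq_ij in i_j.
- by move=> i; rewrite -ltnNge; apply: fix_p.
Qed.

(* A map [q] shifting [lo, ..., N - 1] up by one conjugates each adjacent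
   transposition above [lo] into the next one. *)
Lemma shift_adj_ind lo (P : 'S_N.+1 -> Prop) (q : 'S_N.+1) :
  P (adj lo) -> P q -> (forall i, lo <= i -> i < N -> q (inord i) = inord i.+1) ->
  (forall p q, P p -> P q -> P (p * q)) -> lo < N ->
  forall p : 'S_N.+1, (forall i : 'I_N.+1, i < lo -> p i = i) -> P p.
Proof.
move=> Plo Pq qE PM loN; apply: (adj_ind (lo := lo)) => // i lo_i.
have PX p m : P p -> P (p ^+ m.+1).
  by move=> Pp; elim: m => // m IHm; rewrite expgS; apply: PM.
(* In a finite group an inverse is a power, so closure under products suffices. *)
have PV p : P p -> P p^-1.
  move=> Pp; rewrite invg_expg; case: _.-1 => [|m]; last exact: PX.
  by rewrite expg0 -(tperm2 (inord lo) (inord lo.+1)); apply: (PM).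
elim: i lo_i => [|i IHi] lo_i iN; first by rewrite (_ : 0 = lo) //; lia.
move: lo_i; rewrite leq_eqVlt => /orP[/eqP<- //|lo_i].
have -> : adj i.+1 = adj i ^ q by rewrite /adj tpermJ !qE //; lia.
by apply: (PM); [apply: PV|apply: (PM) => //; apply: IHi; lia].
Qed.

Lemma adjJ i : i.+1 < N ->
  adj i.+1 ^ adj i = tperm (inord i) (inord i.+2) /\
  adj i ^ adj i.+1 = tperm (inord i) (inord i.+2).
Proof.
move=> iN; rewrite /adj !tpermJ !(tpermL, tpermR).
by split; congr tperm; rewrite tpermD // inord_eq //; lia.
Qed.

Lemma coxeter_adj : coxeter N adj.
Proof.
split=> [i iN|i iN|i j ij jN]; first exact: tperm2.
  have [] := adjJ iN; rewrite /conjg {1}/adj tpermV {3}/adj tpermV -!/(adj _).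
  by rewrite -!mulgA => -> ->.
apply/commgP/conjg_fixP; rewrite /adj tpermJ.
by congr tperm; rewrite tpermD // inord_eq //; lia.
Qed.

(** The image of the last point recovers where a run starts. *)
Lemma desc_adjE j l : j + l <= N -> desc adj j l (inord (j + l)) = inord j.
Proof.
elim: l => [|l IHl] jl; first by rewrite perm1 addn0.
by rewrite permM addnS tpermR IHl //; lia.
Qed.

End AdjacentTranspositions.

(** * Coxeter's presentation *)

Section CoxeterPresentation.

Variables (N : nat) (M : monoidType) (s : nat -> M).
Hypotheses (N_gt0 : 0 < N) (cox_s : coxeter N s).

Local Notation adj := (adj N).

(* [x] and [p] are the values in [M] and in the symmetric group of one word in
   the first [k] generators. *)
Inductive cox (k : nat) : M -> 'S_N.+1 -> Prop :=
| Cox1 : cox k 1 1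
| CoxS i x p : i < k -> cox k x p -> cox k (x * s i) (p * adj i).

Lemma cox_fix k x p (j : 'I_N.+1) : k <= N -> cox k x p -> k < j -> p j = j.
Proof.
move=> kN + kj; elim=> [|i {}x {}p ik _ IH]; first by rewrite perm1.
by rewrite permM IH tpermD // -val_eqE /= inordK //; have := ltn_ord j; lia.
Qed.

(** Appending a letter [i] to a run ending in [j] has four outcomes: for [i + 1 < j] it commutes
    past the run, for [i + 1 = j] it prolongs the run, for [i = j] it cancels the last letter, and
    for [i > j] it passes the run as [i - 1]. *)
Lemma cox_coset k x p : k < N -> cox k.+1 x p ->
  exists y q j l, [/\ cox k y q, (j + l = k.+1)%N, x = y * desc s j l & p = q * desc adj j l].
Proof.
move=> kN; elim=> [|i {}x {}p ik _ [y [q [j [l [yq jl -> ->]]]]]].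
  by exists 1, 1, k.+1, 0; split; rewrite ?mulg1 ?addn0 //; constructor.
rewrite -!mulgA; have [ij|ji] := ltnP i j.
  have [i1j|] := ltnP i.+1 j.
    exists (y * s i), (q * adj i), j, l; split => //; first by apply: CoxS => //; lia.
      by rewrite -!mulgA (desc_comm cox_s) //; lia.
    by rewrite -!mulgA (desc_comm (coxeter_adj N)) //; lia.
  move=> ji; have ? : j = i.+1 by lia.
  by subst j; exists y, q, i, l.+1; split; rewrite ?descSr //; lia.
move: ji; rewrite leq_eqVlt => /orP[/eqP ij|ji].
  subst i; case: l jl => [|l] jl; first lia.
  exists y, q, j.+1, l; split; rewrite ?addSnnS ?descSr //.
    by rewrite -[_ * _ * s j]mulgA (coxeter_invol cox_s) ?mulg1 //; lia.
  by rewrite -[_ * _ * adj j]mulgA (coxeter_invol (coxeter_adj N)) ?mulg1 //; lia.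
case: i ik ji => // i ik ji.
exists (y * s i), (q * adj i), j, l; split => //; first by apply: CoxS => //; lia.
  by rewrite -!mulgA (desc_braid cox_s) //; lia.
by rewrite -!mulgA (desc_braid (coxeter_adj N)) //; lia.
Qed.

(** The last point is fixed by the prefix in the first [k] letters and sent to [j] by the run, so a
    word acting trivially has an empty run, and induction on [k] applies. *)
Lemma cox_inj1 k x : k <= N -> cox k x 1 -> x = 1.
Proof.
elim: k x => [|k IHk] x kN.
  move: {2}1 (erefl (1 : 'S_N.+1)) => p; by move=> p1 x1; case: x1 p1.
case/(cox_coset kN) => y [q [j [l [yq jl -> e1]]]].
have := congr1 (fun p : 'S_N.+1 => p (inord k.+1)) e1.
rewrite perm1 permM (cox_fix (ltnW kN) yq) ?inordK // -jl desc_adjE ?jl //.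
move/eqP; rewrite inord_eq //; last lia.
move=> /eqP kj; have l0 : l = 0 by lia.
by move: e1; rewrite l0 /= !mulg1 => e1; apply: IHk (ltnW kN) _; rewrite e1.
Qed.

Lemma coxM k x y p q : cox k x p -> cox k y q -> cox k (x * y) (p * q).
Proof.
by move=> xp; elim=> [|i {}y {}q ik _ ?]; rewrite ?mulg1 // !mulgA; constructor.
Qed.

Lemma coxV k x p : k <= N -> cox k x p -> exists y, [/\ cox k y p^-1, x * y = 1 & y * x = 1].
Proof.
move=> kN; elim=> [|i {}x {}p ik xp [y [yp xy yx]]].
  by exists 1; rewrite invg1 mulg1; split=> //; constructor.
have ss : s i * s i = 1 by apply: (coxeter_invol cox_s); lia.
exists (s i * y); split.
- rewrite invMg; apply: coxM => //; rewrite tpermV -[s i]mul1g -[tperm _ _]mul1g.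
  by apply: CoxS ik _; constructor.
- by rewrite -mulgA (mulgA (s i)) ss mul1g.
- by rewrite mulgA -(mulgA _ y) yx mulg1.
Qed.

Lemma cox_total p : exists x, cox N x p.
Proof.
apply: (adj_ind (P := fun p => exists x, cox N x p) (lo := 0)) => // [i _ iN|{}p q [x xp] [y yq]].
  exists (s i); rewrite -[s i]mul1g -[adj i]mul1g.
  by apply: CoxS => //; constructor.
by exists (x * y); apply: coxM.
Qed.

Lemma cox_inj x y p : cox N x p -> cox N y p -> x = y.
Proof.
move=> xp yp; have [z [zp xz _]] := coxV (leqnn N) xp.
have zy : z * y = 1 by apply: (cox_inj1 (leqnn N)); rewrite -(mulVg p); apply: coxM.
by rewrite -[x]mulg1 -zy mulgA xz mul1g.
Qed.

(** Each permutation is related by [cox N] to exactly one element of [M], so [cox N] is the graph of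
    the required morphism. *)
Theorem coxeter_presentation : exists sg : 'S_N.+1 -> M,
  [/\ sg 1 = 1, {morph sg : p q / p * q} & forall i, i < N -> sg (adj i) = s i].
Proof.
have /choice[sg sgP] := cox_total; exists sg; split=> [|p q|i iN].
- by apply: cox_inj (sgP 1) _; constructor.
- by apply: cox_inj (sgP _) _; apply: coxM.
- apply: cox_inj (sgP _) _; rewrite -[s i]mul1g -[adj i]mul1g.
  by apply: CoxS => //; constructor.
Qed.

End CoxeterPresentation.

(** The action of $b_0$ on the leaves, written as a full descending run so that it can be compared
    letter by letter with a product in a monoid. *)
Definition cyc (N : nat) : 'S_N.+1 := desc (adj N) 0 N.

Lemma adjE N i h : i < N -> h <= N ->
  adj N i (inord h) = inord (if h == i then i.+1 else if h == i.+1 then i else h).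
Proof.
move=> iN hN; rewrite /adj; case: ifP => [/eqP->|hi]; first by rewrite tpermL.
case: ifP => [/eqP->|hi1]; first by rewrite tpermR.
by rewrite tpermD // inord_eq //; lia.
Qed.

Lemma cycE N (i : 'I_N.+1) : cyc N i = inord (if i == N :> nat then 0 else i.+1).
Proof.
have H h l : l <= N -> h <= N -> desc (adj N) 0 l (inord h) =
   inord (if h == l then 0 else if h < l then h.+1 else h).
  elim: l h => [|l IHl] h lN hN; first by rewrite perm1; case: eqP => [->|].
  rewrite permM add0n adjE // IHl ?(ltnW lN) //; last by do 2?case: ifP => ?; lia.
  by congr inord; do !case: ifP; lia.
rewrite -{1}[i]inord_val /cyc H //; last by have := ltn_ord i; lia.
by congr inord; have := ltn_ord i; case: eqP => // ? ?; case: ltnP => //; lia.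
Qed.

(** * Moore's presentation *)

Section Involutions.

Variables (M : monoidType) (x y : M).
Hypotheses (xx : x * x = 1) (yy : y * y = 1).

Lemma invol_comm : (x * y) ^+ 2 = 1 -> x * y = y * x.
Proof.
move=> xy2; rewrite -[RHS]mul1g -xy2 expg2 -!mulgA.
by rewrite (mulgA y y) yy mul1g xx mulg1.
Qed.

Lemma invol_braid : (x * y) ^+ 3 = 1 -> x * y * x = y * x * y.
Proof.
move=> xy3; rewrite -[RHS]mul1g -xy3 expgS expg2 -!mulgA (mulgA y y) yy mul1g.
by rewrite (mulgA x x) xx mul1g yy mulg1.
Qed.

End Involutions.

(* Moore's relations on a transposition [a] and an [N.+1]-cycle [b]. *)
Record moore (M : monoidType) (N : nat) (a b : M) : Prop := Moore {
  moore_a : a ^+ 2 = 1;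
  moore_b : b ^+ N.+1 = 1;
  moore_ba : (b * a) ^+ N = 1;
  moore_braid : (a * b ^+ N * a * b) ^+ 3 = 1;
  moore_comm : forall j, 2 <= j <= N.-1 ->
    (a * b ^+ (N.+1 - j) * a * b ^+ j) ^+ 2 = 1 }.

Section MoorePresentation.

Variables (N : nat) (M : monoidType) (a b : M).
Hypotheses (N_gt1 : 1 < N) (moore_ab : moore N a b).

(** The conjugate of [a] by the [i]-th power of [b]; in a monoid, [b ^+ (N.+1 - i)] serves as the
    inverse power. *)
Let s i := b ^+ (N.+1 - i) * a * b ^+ i.

Let bV i : i <= N.+1 -> b ^+ i * b ^+ (N.+1 - i) = 1.
Proof. by move=> iN; rewrite -expgD subnKC // (moore_b moore_ab). Qed.

Let Vb i : i <= N.+1 -> b ^+ (N.+1 - i) * b ^+ i = 1.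
Proof. by move=> iN; rewrite -expgD subnK // (moore_b moore_ab). Qed.

Let sS i j : i + j <= N.+1 -> s (i + j) = b ^+ (N.+1 - i) * s j * b ^+ i.
Proof.
move=> ijN; rewrite /s !mulgA -expgD -(mulgA _ (b ^+ j)) -expgD.
have -> : (N.+1 - i + (N.+1 - j) = N.+1 + (N.+1 - (i + j)))%N by lia.
by rewrite (expgD b N.+1) (moore_b moore_ab) mul1g [(j + i)%N]addnC.
Qed.

Let conjM i x y : i <= N.+1 ->
  (b ^+ (N.+1 - i) * x * b ^+ i) * (b ^+ (N.+1 - i) * y * b ^+ i) =
  b ^+ (N.+1 - i) * (x * y) * b ^+ i.
Proof.
by move=> iN; rewrite !mulgA -(mulgA _ (b ^+ i)) bV // mulg1.
Qed.

Let aa : a * a = 1. Proof. by rewrite -expg2 (moore_a moore_ab). Qed.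

Let s0 : s 0 = a. Proof. by rewrite /s subn0 (moore_b moore_ab) mul1g mulg1. Qed.

Let ss i : i <= N.+1 -> s i * s i = 1.
Proof. by move=> iN; rewrite /s conjM // aa mulg1 Vb. Qed.

(** Conjugation by a power of [b] moves the braid and commutation relations to index 0, where they
    follow from [moore_braid] for [a * s 1] and [moore_comm] for [a * s h] with [h = j - i]. *)
Lemma coxeter_moore : coxeter N s.
Proof.
have s_eq i j : i + j <= N.+1 -> s i = b ^+ (N.+1 - i) * a * b ^+ i by [].
split=> [i iN|i iN|i j ij jN]; first by apply: ss; lia.
  have br : a * s 1 * a = s 1 * a * s 1.
    apply: invol_braid => //; first by apply: ss; lia.
    by rewrite -(moore_braid moore_ab) /s expg1 subn1 /= !mulgA.
  rewrite -[i.+1]addn1 (sS (i := i)) -?[s i]/(_ * a * _); last lia.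
  by rewrite !conjM ?br //; lia.
have [h ejh] : exists h, (j = i + h)%N by exists (j - i)%N; lia.
have h2 : 2 <= h <= N.-1 by lia.
have co : a * s h = s h * a.
  apply: invol_comm => //; first by apply: ss; lia.
  by rewrite -(moore_comm moore_ab h2) /s !mulgA.
rewrite ejh (sS (i := i)) -?[s i]/(_ * a * _); last lia.
by rewrite !conjM ?co //; lia.
Qed.

(** The powers of [b * a] telescope to [b ^+ r * desc s 0 r]; at [r = N] this is 1, so the run is
    the inverse of [b ^+ N], which is [b]. *)
Lemma moore_cyc : desc s 0 N = b.
Proof.
have H r : r <= N -> (b * a) ^+ r = b ^+ r * desc s 0 r.
  elim: r => [|r IHr] rN; first by rewrite mulg1.
  rewrite expgS IHr /=; last lia.
  by rewrite /s add0n expgS !mulgA -(mulgA b (b ^+ r) (b ^+ (N.+1 - r))) bV ?mulg1 //; lia.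
have := H N (leqnn N); rewrite (moore_ba moore_ab) => /(congr1 (fun x => b * x)) /=.
by rewrite mulgA -expgS (moore_b moore_ab) mul1g mulg1.
Qed.

Theorem moore_presentation : exists sg : 'S_N.+1 -> M,
  [/\ sg 1 = 1, {morph sg : p q / p * q}, sg (adj N 0) = a & sg (cyc N) = b].
Proof.
have [sg [sg1 sgM sgs]] := coxeter_presentation (ltnW N_gt1) coxeter_moore.
exists sg; split; rewrite ?sgs ?s0 //; first lia.
rewrite -moore_cyc /cyc; have H l : l <= N -> sg (desc (adj N) 0 l) = desc s 0 l.
  by elim: l => [|l IHl] lN //; rewrite /= sgM sgs ?add0n // IHl //; lia.
exact: H.
Qed.

End MoorePresentation.

(** * The relations hold for partial maps of the star *)

Section WordEvaluation.

Variables (X : choiceType) (M : monoidType) (g : X -> M).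

Definition weval (w : word X) : M := foldr (fun x y => g x * y) 1 w.

Lemma wevalM (u v : word X) : weval (u * v) = weval u * weval v.
Proof.
rewrite /weval [u * v]/(u ++ v) foldr_cat.
by elim: u => [|x u IHu] /=; rewrite ?mul1g // IHu mulgA.
Qed.

Lemma weval_cong (R : word X -> word X -> Prop) :
  (forall u v, R u v -> weval u = weval v) ->
  forall u v, cong R u v -> weval u = weval v.
Proof.
move=> HR u v; elim=> {u v} [u v /HR||u v _ ->|u v w _ -> _ ->|u v u' v' _ eu _ ev] //.
by rewrite !wevalM eu ev.
Qed.

Lemma weval_letter x : weval (letter x) = g x.
Proof. exact: mulg1. Qed.

Lemma weval1 : weval 1 = 1.
Proof. by []. Qed.

Lemma wevalX (u : word X) k : weval (u ^+ k) = weval u ^+ k.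
Proof. by elim: k => // k IHk; rewrite !expgS wevalM IHk. Qed.

Lemma definesP (R : word X -> word X -> Prop) :
  (forall u v, R u v -> weval u = weval v) ->
  (forall y, exists w, weval w = y) ->
  (forall u v, weval u = weval v -> cong R u v) -> defines R g.
Proof.
move=> HR surj inj; pose phi (x : quot_monoid R) := weval (generic_quotient.repr x).
have phiE w : phi (wclass R w) = weval w.
  by apply: (weval_cong HR); apply/wclassP; rewrite reprK_wclass.
have [psi psiK] := choice surj.
exists phi; split.
- split=> [|x y]; first exact: phiE.
  by rewrite -[x]reprK_wclass -[y]reprK_wclass -[_ * _]wclassM !phiE wevalM.
- exists (fun y => wclass R (psi y)) => [x|y]; last by rewrite phiE.
  by rewrite -[RHS]reprK_wclass; apply/wclassP/inj; rewrite psiK.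
- by move=> x; rewrite phiE weval_letter.
Qed.

End WordEvaluation.

Ltac split_ifs :=
  repeat match goal with
  | |- context [if ?b then _ else _] =>
    lazymatch b with
    | context [if _ then _ else _] => fail
    | _ => let E := fresh "E" in destruct b eqn:E; try (exfalso; lia); cbn [obind oapp]
    end
  end.

Ltac some_lia := first [by [] | lia | congr Some; lia].

Section Relations.

Variable n : nat.
Hypothesis n4 : 4 <= n.

Definition nat_gen (x : alphabet) : nat -> option nat :=
  match x with
  | La0 => fun_a0 | Lb0 => fun_b0 n | Le1 => fun_e1 n
  | Lc => fun_c | Ld => fun_d | Lz1 => fun_z1
  end.

(** Words act on natural numbers rather than ordinals, so that the relations become arithmetic case
    distinctions. *)
Definition run (w : word alphabet) (i : nat) : option nat :=
  foldl (fun o x => obind (nat_gen x) o) (Some i) w.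

Lemma runM u v i : run (u * v) i = obind (run v) (run u i).
Proof.
rewrite /run [u * v]/(u ++ v) foldl_cat; case: (foldl _ _ u) => //=.
by elim: v => //=.
Qed.

Lemma run_letter x i : run (letter x) i = nat_gen x i.
Proof. by []. Qed.

(** [ptrans_of] discards values that are too large; this bound shows that none occur, so the partial
    maps agree with [run]. *)
Lemma nat_gen_lt x i j : i < n -> nat_gen x i = Some j -> j < n.
Proof.
move=> i_n; case: x => /=; rewrite /fun_a0 /fun_b0 /fun_e1 /fun_c /fun_d /fun_z1;
  do ?case: eqP => ?; do ?case: leqP => ? //; case; lia.
Qed.

Lemma generatorE x (i : 'I_n) :
  iend_val (generator n x) i = obind insub (nat_gen x i).
Proof. by case: x; rewrite ffunE. Qed.

Lemma weval_run w (i : 'I_n) :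
  iend_val (weval (generator n) w) i = obind insub (run w i).
Proof.
elim: w i => [|x w IHw] i; first by rewrite /= ffunE valK.
rewrite [LHS]ffunE generatorE -[x :: w]/(letter x * w) runM run_letter.
case E: nat_gen => [j|] //=; have jn := nat_gen_lt (ltn_ord i) E.
by rewrite insubT /= IHw.
Qed.

Lemma run_b0X j i : j <= n - 1 -> i < n ->
  run (letter Lb0 ^+ j) i =
  Some (if i == 0 then 0 else if i + j <= n - 1 then i + j else i + j - (n - 1)).
Proof.
elim: j => [|j IHj] jn i_n; first by rewrite expg0 /run /=; split_ifs; some_lia.
rewrite expgSr runM IHj //=; last lia.
by rewrite run_letter /= /fun_b0; split_ifs; some_lia.
Qed.

(** The product of the two letters fixes 0 and 1 and cycles the other [n - 2] vertices, whence
    [R3]. *)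
Lemma run_b0a0X j i : j <= n - 2 -> i < n ->
  run ((letter Lb0 * letter La0) ^+ j) i =
  Some (if i <= 1 then i else if i + j <= n - 1 then i + j else i + j - (n - 2)).
Proof.
elim: j => [|j IHj] jn i_n; first by rewrite expg0 /run /=; split_ifs; some_lia.
rewrite expgSr runM IHj //=; last lia.
by rewrite runM !run_letter /= run_letter /= /fun_b0 /fun_a0; split_ifs; some_lia.
Qed.

Lemma run_e1b0X j i : j <= n - 2 -> i < n ->
  run ((letter Le1 * letter Lb0) ^+ j) i =
  if i == 0 then Some 0 else if i + j <= n - 1 then Some (i + j)%N else None.
Proof.
elim: j => [|j IHj] jn i_n; first by rewrite expg0 /run /=; split_ifs; some_lia.
rewrite expgSr runM IHj //=; last lia.
split_ifs; rewrite ?runM ?run_letter /= /fun_e1 /=; split_ifs;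
  rewrite ?run_letter /= /fun_b0 /=; split_ifs; some_lia.
Qed.

End Relations.

Ltac run_step :=
  rewrite ?runM; cbn [obind oapp];
  rewrite ?run_letter ?run_b0X; [|lia..];
  rewrite /nat_gen /fun_a0 /fun_b0 /fun_e1 /fun_c /fun_d /fun_z1;
  cbn [obind oapp]; split_ifs.

(** Closed forms handle [R3] and [R17]; in the other relations only powers of the letter [Lb0] have
    a variable exponent. *)
Lemma Rbar_run n u v i : 4 <= n -> i < n -> Rbar n u v -> run n u i = run n v i.
Proof.
move=> n4 i_n; case; try by rewrite run_b0a0X //; split_ifs; some_lia.
all: try (rewrite runM run_e1b0X //; [|lia]).
all: try move=> j j_n.
all: rewrite ?expg2 ?[_ ^+ 3]expgS ?expg2; repeat run_step; some_lia.
Qed.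

Lemma Rbar_generator n u v : 4 <= n -> Rbar n u v ->
  weval (generator n) u = weval (generator n) v.
Proof.
move=> n4 uv; apply: val_inj; apply/ffunP => i.
by rewrite /= !weval_run // (Rbar_run n4 (ltn_ord i) uv).
Qed.

(** * Normal forms *)

Lemma weval_moore (N : nat) (M : monoidType) (g : alphabet -> M) :
  1 < N -> (forall u v, Rbar N.+2 u v -> weval g u = weval g v) ->
  moore N (g La0) (g Lb0).
Proof.
move=> N1 Hg; split=> [||||j j_N].
- by have := Hg _ _ (R1 _); rewrite wevalX weval_letter weval1.
- by have := Hg _ _ (R2 _); rewrite wevalX weval_letter weval1 subn1.
- by have := Hg _ _ (R3 _); rewrite wevalX wevalM !weval_letter weval1 !subSS subn0.
- have := Hg _ _ (R4 _).
  by rewrite wevalX !wevalM wevalX !weval_letter weval1 !subSS subn0.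
- have j_n : 2 <= j <= N.+2 - 3 by lia.
  have := Hg _ _ (R5 j_n).
  by rewrite wevalX !wevalM !wevalX !weval_letter weval1 subn1.
Qed.

(** One point is treated at a time: composing with [tperm (p x) y] corrects the value at [x], and
    injectivity of [p] and [f] protects the values already right. *)
Lemma perm_extend (T : finType) (f : T -> option T) :
  (forall x y z, f x = Some z -> f y = Some z -> x = y) ->
  exists p : {perm T}, forall x y, f x = Some y -> p x = y.
Proof.
move=> f_inj; suff [p pP] : exists p : {perm T}, forall x y,
    x \in enum T -> f x = Some y -> p x = y.
  by exists p => x y; apply: pP; rewrite mem_enum.
elim: (enum T) => [|x s [p pP]]; first by exists 1.
have [xs|xs] := boolP (x \in s).
  by exists p => x' y; rewrite inE => /orP[/eqP->|]; apply: pP.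
case fx: (f x) => [y|]; last first.
  by exists p => x' y; rewrite inE => /orP[/eqP->|]; [rewrite fx|apply: pP].
exists (p * tperm (p x) y) => x' y'; rewrite inE permM => /orP[/eqP->|x's] fx'.
  by move: fx'; rewrite fx tpermL => -[].
have x'x : x' != x by apply: contraNneq xs => <-.
rewrite (pP _ _ x's fx') tpermD //.
  by rewrite -(pP _ _ x's fx') (inj_eq perm_inj) eq_sym.
by apply: contraNneq x'x => yy'; apply/eqP/(f_inj _ _ _ fx'); rewrite fx yy'.
Qed.

(* Leaves are indexed from 0: [i : 'I_N.+1] stands for the vertex [i.+1], and
   [n = N.+2]. *)
Section StarRelations.

Variables (N : nat) (M : monoidType) (g : alphabet -> M).
Hypotheses (N_gt1 : 1 < N) (Hg : forall u v, Rbar N.+2 u v -> weval g u = weval g v).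

Local Notation leafT := 'I_N.+1.
Local Notation a := (g La0).
Local Notation b := (g Lb0).
Local Notation e := (g Le1).
Local Notation c := (g Lc).
Local Notation d := (g Ld).
Local Notation z := (g Lz1).

Implicit Types (p q : 'S_N.+1) (i j : leafT).

Variable sg : 'S_N.+1 -> M.
Hypotheses (sg1 : sg 1 = 1) (sgM : {morph sg : p q / p * q}).
Hypotheses (sga : sg (adj N 0) = a) (sgb : sg (cyc N) = b).

Lemma sgK p x : sg p * (sg p^-1 * x) = x.
Proof. by rewrite mulgA -sgM mulgV sg1 mul1g. Qed.

Lemma sgVK p x : sg p^-1 * (sg p * x) = x.
Proof. by rewrite mulgA -sgM mulVg sg1 mul1g. Qed.

Lemma inord0 : inord 0 = ord0 :> leafT.
Proof. by apply: val_inj; rewrite /= inordK. Qed.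

Lemma cyc_inord h : h < N -> cyc N (inord h) = inord h.+1.
Proof. by move=> hN; rewrite cycE inordK 1?ltnW //; case: eqP => // ?; lia. Qed.

Lemma cyc_max : cyc N ord_max = ord0.
Proof. by rewrite cycE /= eqxx inord0. Qed.

Lemma cyca_inord h : 0 < h -> h < N -> (cyc N * adj N 0) (inord h) = inord h.+1.
Proof.
move=> h0 hN; rewrite permM cyc_inord // adjE //; last lia.
by congr inord; do !case: eqP; lia.
Qed.

(** The stabiliser of leaf 0 is generated by the transposition of leaves 1 and 2, a conjugate of [a]
    by [b], and by the cycle [b * a]; rules for the stabiliser are thus checked on these two. *)
Lemma sg_stab_ind (P : M -> Prop) :
  P (sg (cyc N)^-1 * a * b) -> P (b * a) ->
  (forall x y, P x -> P y -> P (x * y)) ->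
  forall p : 'S_N.+1, p ord0 = ord0 -> P (sg p).
Proof.
move=> Padj Pcyc PM p p0.
apply: (shift_adj_ind (lo := 1) (P := fun p => P (sg p)) (q := cyc N * adj N 0)).
- rewrite (_ : adj N 1 = (cyc N)^-1 * (adj N 0 * cyc N)).
    by rewrite mulgA !sgM sga sgb.
  by rewrite -[RHS]/(adj N 0 ^ cyc N) /adj tpermJ !cyc_inord //; lia.
- by rewrite sgM sga sgb.
- exact: cyca_inord.
- by move=> q r; rewrite sgM; apply: PM.
- by [].
- by move=> i i1; have -> : i = ord0 by apply: val_inj => /=; lia.
Qed.

(** * Leaf idempotents and the symmetric inverse monoid *)

Lemma bV : b ^+ N = sg (cyc N)^-1.
Proof.
have [_ bN _ _ _] := weval_moore N_gt1 Hg.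
by rewrite -[RHS]mul1g -bN expgSr -sgb -mulgA -sgM mulgV sg1 mulg1.
Qed.

(* [eps i] is the partial identity omitting the leaf [i], and [eps0 = eps ord0].
   Locked, since the associativity rules would otherwise match through the
   definitions. *)
Definition eps0 : M := locked (sg (cyc N)^-1 * e * b).
Definition swap0 (i : leafT) : 'S_N.+1 := tperm ord0 i.
Definition eps (i : leafT) : M := locked (sg (swap0 i) * eps0 * sg (swap0 i)).

Lemma eps0_def : eps0 = sg (cyc N)^-1 * e * b.
Proof. by rewrite /eps0 -lock. Qed.

Lemma eps_def i : eps i = sg (swap0 i) * eps0 * sg (swap0 i).
Proof. by rewrite /eps -lock. Qed.

Lemma swap00 : swap0 ord0 = 1. Proof. exact: tperm1. Qed.
Lemma swap0_sgK i x : sg (swap0 i) * (sg (swap0 i) * x) = x.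
Proof. by rewrite -{1}[swap0 i]tpermV sgVK. Qed.
Lemma swap0K i : sg (swap0 i) * sg (swap0 i) = 1.
Proof. by rewrite -sgM tperm2 sg1. Qed.

Lemma rel7_ae : a * e = e * a.
Proof. by have := Hg (R7_a0e1 _); rewrite !wevalM !weval_letter. Qed.
Lemma rel7_da : d * a = a * d.
Proof. by have := Hg (R7_da0 _); rewrite !wevalM !weval_letter. Qed.
Lemma rel7_db : d * b = b * d.
Proof. by have := Hg (R7_db0 _); rewrite !wevalM !weval_letter. Qed.
Lemma rel7_de : d * e = e * d.
Proof. by have := Hg (R7_de1 _); rewrite !wevalM !weval_letter. Qed.
Lemma rel6_e : e * e = e.
Proof. by have := Hg (R6_e1 _); rewrite expg2 !wevalM !weval_letter. Qed.
Lemma rel6_d : d * d = d.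
Proof. by have := Hg (R6_d _); rewrite expg2 !wevalM !weval_letter. Qed.

Lemma aa : a * a = 1.
Proof. by rewrite -sga -sgM tperm2 sg1. Qed.

Lemma bVb x : sg (cyc N)^-1 * (b * x) = x.
Proof. by rewrite -sgb sgVK. Qed.
Lemma bbV x : b * (sg (cyc N)^-1 * x) = x.
Proof. by rewrite -sgb sgK. Qed.

Lemma rel8 : b * a * eps0 = eps0 * (b * a).
Proof.
have := Hg (R8 _); rewrite !wevalM !wevalX !weval_letter subSS subn1 /= bV => r8.
by rewrite eps0_def -[in RHS]r8 -!mulgA bVb aa mulg1.
Qed.

Lemma eps0_stab (p : 'S_N.+1) : p ord0 = ord0 -> sg p * eps0 = eps0 * sg p.
Proof.
move: p; apply: (sg_stab_ind (P := fun x => x * eps0 = eps0 * x)).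
- by rewrite eps0_def -!mulgA bbV (mulgA a) rel7_ae -!mulgA bbV.
- exact: rel8.
- by move=> x y xe ye; rewrite -mulgA ye !mulgA xe.
Qed.

(** The permutation [swap0 i * p * swap0 (p i)] fixes leaf 0, hence commutes with [eps0]. *)
Lemma eps_sg i (p : 'S_N.+1) : eps i * sg p = sg p * eps (p i).
Proof.
have q0 : (swap0 i * p * swap0 (p i)) ord0 = ord0 by rewrite !permM tpermL tpermR.
have eq := eps0_stab q0; rewrite !sgM in eq.
rewrite !eps_def -[RHS](swap0_sgK i) -!mulgA; congr (_ * _).
by rewrite !mulgA eq -!mulgA swap0K mulg1.
Qed.

Lemma sg_eps i (p : 'S_N.+1) : sg p * eps i = eps (p^-1 i) * sg p.
Proof. by rewrite eps_sg permKV. Qed.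

Lemma eps_perm i (p : 'S_N.+1) : eps (p i) = sg p^-1 * (eps i * sg p).
Proof. by rewrite eps_sg sgVK. Qed.

Lemma eps0E : eps ord0 = eps0.
Proof. by rewrite eps_def swap00 sg1 mulg1 mul1g. Qed.

Lemma eps_max : eps ord_max = e.
Proof.
have := eps_sg ord_max (cyc N); rewrite cyc_max eps0E eps0_def sgb -!mulgA bbV.
by move=> /(congr1 (fun x => x * sg (cyc N)^-1)); rewrite -!mulgA -sgb -sgM mulgV sg1 !mulg1.
Qed.

Lemma epsI i : eps i * eps i = eps i.
Proof.
rewrite eps_def -!mulgA swap0_sgK; congr (_ * _); rewrite !mulgA; congr (_ * _).
by rewrite eps0_def -!mulgA bbV (mulgA e) rel6_e.
Qed.

Definition leaf1 : leafT := inord 1.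

Lemma leaf1N0 : leaf1 != ord0.
Proof. by rewrite -val_eqE /= inordK //; lia. Qed.

(** Carries the identities that [R9] and [R10] give for leaves 0 and 1 to any two distinct
    leaves. *)
Lemma two_transitive (i j : leafT) : i != j ->
  exists p : 'S_N.+1, p ord0 = i /\ p leaf1 = j.
Proof.
move=> i_j; exists (swap0 i * tperm (swap0 i leaf1) j); split.
  rewrite permM tpermL tpermD 1?eq_sym //; apply: contraNneq leaf1N0 => ei.
  by apply/eqP/(@perm_inj _ (swap0 i)); rewrite -ei /swap0 tpermL.
by rewrite permM tpermL.
Qed.

Lemma a_swap0 : a = sg (swap0 leaf1).
Proof. by rewrite -sga /adj inord0. Qed.

Lemma aeps0 : a * eps0 = eps leaf1 * a.
Proof. by rewrite a_swap0 -eps0E sg_eps tpermV tpermL. Qed.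

Lemma aeps1 : a * eps leaf1 = eps0 * a.
Proof. by rewrite a_swap0 sg_eps tpermV tpermR eps0E. Qed.

Lemma aeps2 : (a * eps0) ^+ 2 = eps leaf1 * eps0.
Proof. by rewrite expg2 aeps0 -!mulgA (mulgA a) aeps1 -mulgA aa mulg1. Qed.

(** For leaves 0 and 1, the two sides of [R9] are the two orders of the product. *)
Lemma eps_comm i j : eps i * eps j = eps j * eps i.
Proof.
have [->//|i_j] := eqVneq i j.
have [p [<- <-]] := two_transitive i_j.
have H : eps0 * eps leaf1 = eps leaf1 * eps0.
  have : (eps0 * a) ^+ 2 = (a * eps0) ^+ 2.
    have := Hg (R9 _); rewrite !wevalX !wevalM !wevalX !weval_letter subSS subn1 /= bV.
    by rewrite eps0_def !mulgA.
  by rewrite aeps2 => <-; rewrite expg2 -!mulgA (mulgA a) aeps0 -mulgA aa mulg1.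
by rewrite !eps_perm eps0E -!mulgA !sgK (mulgA eps0) H -mulgA.
Qed.

(** Exchanging two omitted leaves has no effect; for leaves 0 and 1 this comes from [R10]. *)
Lemma eps_tperm i j : eps i * eps j * sg (tperm i j) = eps i * eps j.
Proof.
have [->|i_j] := eqVneq i j; first by rewrite tperm1 sg1 mulg1.
have [p [<- <-]] := two_transitive i_j.
have H : eps0 * eps leaf1 * a = eps0 * eps leaf1.
  have : eps0 * a * eps0 = (a * eps0) ^+ 2.
    have := Hg (R10 _); rewrite !wevalX !wevalM !wevalX !weval_letter subSS subn1 /= bV.
    by rewrite eps0_def !mulgA.
  by rewrite aeps2 -mulgA aeps0 mulgA -eps0E [RHS]eps_comm.
rewrite !eps_perm -tpermJ /conjg !sgM -[tperm _ leaf1]/(swap0 leaf1) -a_swap0 eps0E.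
by rewrite -!mulgA !sgK (mulgA (eps leaf1)) (mulgA eps0) (mulgA _ _ a) H -!mulgA.
Qed.

(** The partial identity omitting the leaves in [l]; by [eq_E] it depends only on the set of
    entries. *)
Definition E (l : seq leafT) : M := foldr (fun i x => eps i * x) 1 l.

Lemma E_cons i l : E (i :: l) = eps i * E l. Proof. by []. Qed.

Lemma E_cat l l' : E (l ++ l') = E l * E l'.
Proof. by elim: l => [|i l IHl] /=; rewrite ?mul1g // IHl mulgA. Qed.

Lemma E_comm_eps i l : eps i * E l = E l * eps i.
Proof.
by elim: l => [|j l IHl] /=; rewrite ?mul1g ?mulg1 // mulgA eps_comm -!mulgA IHl.
Qed.

Lemma E_comm l l' : E l * E l' = E l' * E l.
Proof.
by elim: l => [|j l IHl] /=; rewrite ?mul1g ?mulg1 // -mulgA IHl !mulgA E_comm_eps.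
Qed.

Lemma eps_E i l : i \in l -> eps i * E l = E l.
Proof.
elim: l => //= j l IHl; rewrite inE => /orP[/eqP->|/IHl il]; first by rewrite mulgA epsI.
by rewrite mulgA eps_comm -mulgA il.
Qed.

Lemma E_sub l l' : {subset l <= l'} -> E l * E l' = E l'.
Proof.
elim: l => [|i l IHl] ll' /=; first by rewrite mul1g.
rewrite -mulgA IHl ?eps_E //; first by apply: ll'; rewrite mem_head.
by move=> j jl; apply: ll'; rewrite inE jl orbT.
Qed.

Lemma eq_E l l' : l =i l' -> E l = E l'.
Proof.
move=> ll'; rewrite -(@E_sub l l') => [|i]; last by rewrite ll'.
by rewrite E_comm E_sub // => i; rewrite ll'.
Qed.

Lemma E_sg l (p : 'S_N.+1) : E l * sg p = sg p * E (map p l).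
Proof.
by elim: l => [|i l IHl] /=; rewrite ?mul1g ?mulg1 // -mulgA IHl mulgA eps_sg mulgA.
Qed.

Lemma sg_E l (p : 'S_N.+1) : sg p * E l = E (map p^-1 l) * sg p.
Proof. by rewrite E_sg -map_comp (eq_map (permKV p)) map_id. Qed.

(** Such a permutation is a product of transpositions of omitted leaves, each absorbed by
    [eps_tperm]. *)
Lemma E_sg_fix l (p : 'S_N.+1) : (forall i, i \notin l -> p i = i) -> E l * sg p = E l.
Proof.
apply: (@tperm_ind _ (mem l) (fun p => E l * sg p = E l)) => /= [|q i j il jl _ Eq].
  by rewrite sg1 mulg1.
have El : E l = E l * (eps i * eps j).
  by rewrite mulgA -E_comm_eps eps_E // -E_comm_eps eps_E.
by rewrite sgM mulgA Eq El -mulgA eps_tperm.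
Qed.

Lemma eq_E_sg l (p q : 'S_N.+1) : (forall i, i \notin l -> p i = q i) -> E l * sg p = E l * sg q.
Proof.
move=> pq; rewrite -[p](mulgVK q) sgM mulgA (E_sg_fix (p := p * q^-1)) // => i il.
by rewrite permM pq // permK.
Qed.

(** * Relations for [d] and [z] *)

Lemma d_sg p : d * sg p = sg p * d.
Proof.
apply: (shift_adj_ind (lo := 0) (P := fun p => d * sg p = sg p * d) (q := cyc N)) => //.
- by rewrite sga rel7_da.
- by rewrite sgb rel7_db.
- by move=> i _; apply: cyc_inord.
- by move=> q r dq dr; rewrite sgM mulgA dq -mulgA dr mulgA.
- lia.
Qed.

Lemma d_eps i : d * eps i = eps i * d.
Proof.
rewrite eps_def eps0_def -sgb -!mulgA !(mulgA d) d_sg -!mulgA; congr (_ * _).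
rewrite (mulgA d) d_sg -!mulgA; congr (_ * _); rewrite (mulgA d) rel7_de -mulgA.
by rewrite (mulgA d) d_sg -mulgA d_sg.
Qed.

Lemma d_E l : d * E l = E l * d.
Proof.
by elim: l => [|i l IHl] /=; rewrite ?mulg1 ?mul1g // mulgA d_eps -mulgA IHl mulgA.
Qed.

Lemma z_stab p : p ord0 = ord0 -> sg p * z = z.
Proof.
have bVz : b * sg (cyc N)^-1 = 1 by rewrite -[LHS]mulg1 -mulgA bbV.
have baz : b * a * z = z.
  have := Hg (R13 _); rewrite !wevalM !wevalX !weval_letter !subSS subn0 bV => h.
  by rewrite -mulgA -h mulgA bVz mul1g.
move: p; apply: (sg_stab_ind (P := fun x => x * z = z)) => [||x y xz yz] //.
  have j1 : 1 <= 1 <= N.+2 - 3 by lia.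
  have := Hg (R14 j1); rewrite !wevalM !wevalX !weval_letter expg1 => h.
  by rewrite -!mulgA [a * _]mulgA h bVb.
by rewrite -mulgA yz.
Qed.

(* [z] exchanges the centre and the leaf 0, so that [z * z] is the partial
   identity omitting the other leaves. *)
Definition nonzero : seq leafT := [seq i <- enum 'I_N.+1 | i != ord0].

Lemma mem_nonzero i : (i \in nonzero) = (i != ord0).
Proof. by rewrite mem_filter mem_enum andbT. Qed.

Lemma zba : z * b = z * a.
Proof. by have := Hg (R12 _); rewrite !wevalM !weval_letter. Qed.

(** In [R17], the rule [z * b = z * a] turns the right side into [z * z * b ^+ N.-1], and the power
    of [b] cancels against the one on the left. *)
Lemma zzE : z * z = E nonzero.
Proof.
(* Each factor [e * b] adds the next lower leaf to the omitted set; at [h = N.-1] only leaf 0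
   remains. *)
have H h : h < N ->
    (e * b) ^+ h * e = E [seq i : 'I_N.+1 <- enum 'I_N.+1 | N - h <= i] * b ^+ h.
  elim: h => [|h IHh] hN.
    rewrite mul1g mulg1 -eps_max -[LHS]mulg1 -[_ * 1]/(E [:: _]).
    apply: eq_E => i; rewrite mem_filter mem_enum andbT inE subn0 -val_eqE /=.
    by have := ltn_ord i; case: eqP; lia.
  rewrite expgS -!mulgA IHh 1?ltnW // (mulgA b) -sgb sg_E -!mulgA -expgS.
  rewrite mulgA -eps_max -E_cons; congr (_ * _); apply: eq_E => i.
  rewrite inE mem_filter mem_enum andbT -[i in RHS]inord_val.
  have -> : (i \in [seq (cyc N)^-1 i0 | i0 <- [seq i : 'I_N.+1 <- enum 'I_N.+1 | N - h <= i]]) =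
            (N - h <= cyc N i).
    rewrite -{1}[i](permK (cyc N)) mem_map; last exact: perm_inj.
    by rewrite mem_filter mem_enum andbT.
  rewrite cycE -val_eqE /=; have iN := ltn_ord i; rewrite !inordK //; last by case: eqP; lia.
  by case: eqP; lia.
have N1 : N.-1 < N by lia.
have := Hg (R17 _); rewrite !wevalM !wevalX !wevalM !weval_letter.
rewrite (_ : N.+2 - 3 = N.-1)%N; last lia.
rewrite H //; have -> : z * z * a * b ^+ (N.+2 - 4) = z * z * b ^+ N.-1.
  rewrite -[z * z * a]mulgA -zba mulgA -(mulgA _ b) -expgS.
  by congr (_ * _ ^+ _); lia.
have bK : b ^+ N.-1 * b ^+ 2 = 1.
  rewrite -expgD; have [_ <- _ _ _] := weval_moore N_gt1 Hg.
  by congr (_ ^+ _); lia.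
move/(congr1 (fun x => x * b ^+ 2)); rewrite -!mulgA bK !mulg1 => <-.
by apply: eq_E => i; rewrite mem_nonzero mem_filter mem_enum andbT -val_eqE /=; lia.
Qed.

Lemma rel11 : z * (z * z) = z.
Proof. by have := Hg (R11 _); rewrite expgS expg2 !wevalM !weval_letter. Qed.

Lemma E_nonzero_z : E nonzero * z = z.
Proof. by rewrite -zzE -mulgA rel11. Qed.

Lemma z_E_nonzero : z * E nonzero = z.
Proof. by rewrite -zzE rel11. Qed.

Lemma E_nonzero_sg p : p ord0 = ord0 -> E nonzero * sg p = E nonzero.
Proof.
by move=> p0; apply: E_sg_fix => i; rewrite mem_nonzero negbK => /eqP->.
Qed.

Lemma stab_z p : p ord0 = ord0 -> z * sg p = z.
Proof. by move=> p0; rewrite -z_E_nonzero -mulgA E_nonzero_sg. Qed.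

Lemma z_eps i : i != ord0 -> z * eps i = z.
Proof.
by move=> i0; rewrite -{1}z_E_nonzero -mulgA -E_comm_eps eps_E ?mem_nonzero // z_E_nonzero.
Qed.

Lemma sg_factor p (i j : leafT) : p i = j ->
  exists q : 'S_N.+1, [/\ q ord0 = ord0 & p = swap0 i * q * swap0 j].
Proof.
move=> pij; exists (swap0 i * p * swap0 j); split.
  by rewrite !permM tpermL pij tpermR.
by rewrite !mulgA tperm2 mul1g -mulgA tperm2 mulg1.
Qed.

(** By [R15], [z * d = e * b * z] absorbs the stabiliser of the last leaf as well as that of leaf 0,
    and the two together generate all permutations. *)
Lemma sg_zd p : sg p * (z * d) = z * d.
Proof.
have st (q : 'S_N.+1) : q ord0 = ord0 -> sg q * (z * d) = z * d.
  by move=> q0; rewrite mulgA z_stab.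
have ezd : e * b * z = z * d by have := Hg (R15 _); rewrite !wevalM !weval_letter.
have stmax (q : 'S_N.+1) : q ord_max = ord_max -> sg q * (z * d) = z * d.
  move=> qmax; rewrite -ezd -eps_max -sgb eps_sg cyc_max eps0E -!mulgA.
  set r := (cyc N)^-1 * q * cyc N.
  have r0 : r ord0 = ord0 by rewrite !permM -{1}cyc_max permK qmax cyc_max.
  have -> : sg q * (sg (cyc N) * (eps0 * z)) = sg (cyc N) * (sg r * (eps0 * z)).
    by rewrite /r !sgM -!mulgA sgK.
  by rewrite (mulgA (sg r)) eps0_stab // -mulgA z_stab.
have maxN0 : ord_max != ord0 :> leafT by rewrite -val_eqE /=; lia.
have leaf1Nmax : leaf1 != ord_max by rewrite -val_eqE /= inordK; lia.
have stt (i : leafT) : sg (swap0 i) * (z * d) = z * d.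
  have [->|imax] := eqVneq i ord_max; last first.
    by apply: stmax; rewrite tpermD // eq_sym.
  have -> : swap0 ord_max = tperm leaf1 ord_max * swap0 leaf1 * tperm leaf1 ord_max.
    rewrite -mulgA -{1}[tperm leaf1 ord_max]tpermV -[RHS]/(swap0 leaf1 ^ _) tpermJ.
    by rewrite tpermL tpermD // leaf1N0.
  have l10 := leaf1N0; have N0max : ord0 != ord_max :> leafT by rewrite eq_sym.
  by rewrite !sgM -!mulgA st 1?stmax 1?st // ?/swap0 tpermD.
have [q [q0 ->]] := @sg_factor p ord0 (p ord0) erefl.
by rewrite !sgM -!mulgA !(stt, st).
Qed.

Lemma eps0_z : eps0 * z = z * d.
Proof.
have ezd : e * b * z = z * d by have := Hg (R15 _); rewrite !wevalM !weval_letter.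
by rewrite eps0_def -!mulgA (mulgA e) ezd sg_zd.
Qed.

(** The idempotent [z * z] commutes with [eps0] and is absorbed by [z], so it may be appended; then
    [eps0_z] applies. *)
Lemma z_eps0 : z * eps0 = d * z.
Proof.
have -> : z * eps0 = z * eps0 * z * z.
  by rewrite -!mulgA zzE -eps0E E_comm_eps mulgA z_E_nonzero.
by rewrite -[z * eps0 * z]mulgA eps0_z mulgA zzE -[_ * d * z]mulgA mulgA -d_E -mulgA E_nonzero_z.
Qed.

(* [E all_leaves] is the partial identity at the centre. *)
Definition all_leaves : seq leafT := ord0 :: nonzero.

Lemma mem_all_leaves i : i \in all_leaves.
Proof. by rewrite inE mem_nonzero orbN. Qed.

Lemma E_allE : E all_leaves = eps0 * E nonzero.
Proof. by rewrite E_cons eps0E. Qed.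

Lemma E_all_z : E all_leaves * z = z * d.
Proof. by rewrite E_allE -mulgA E_nonzero_z eps0_z. Qed.

Lemma dzd : d * z * d = E all_leaves * d.
Proof.
have := Hg (R19 _); rewrite expg2 !wevalM !weval_letter => <-.
rewrite -{2}z_eps0 !mulgA -[d * z * z]mulgA zzE d_E -[_ * d * eps0]mulgA.
by rewrite -eps0E d_eps mulgA -E_comm_eps.
Qed.

(** * Relations for [c] *)

Lemma epsd_c : eps0 * c = eps0 * d /\ eps0 * d = c * d.
Proof.
have cd : c * d = c * c by have := Hg (R25_cd _); rewrite expg2 !wevalM !weval_letter.
have dc : d * c = c by have := Hg (R24_dc _); rewrite !wevalM !weval_letter.
have de : d * eps0 = c * c.
  have := Hg (R25_de _); rewrite expg2 !wevalM !wevalX !weval_letter !subSS subn0 bV.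
  by rewrite eps0_def !mulgA.
have ed : eps0 * d = c * c by rewrite -de -eps0E d_eps.
split; last by rewrite ed cd.
by rewrite -[in LHS]dc mulgA ed -cd -mulgA dc.
Qed.

Lemma dc : d * c = c.
Proof. by have := Hg (R24_dc _); rewrite !wevalM !weval_letter. Qed.

Lemma c_eps0 : c * eps0 = c.
Proof.
have := Hg (R24_ce _); rewrite !wevalM !wevalX !weval_letter !subSS subn0 bV.
by rewrite eps0_def !mulgA.
Qed.

Lemma c_stab p : p ord0 = ord0 -> c * sg p = sg p * c.
Proof.
move: p; apply: (sg_stab_ind (P := fun x => c * x = x * c)).
- have := Hg (R26_bab _); rewrite !wevalM !wevalX !weval_letter !subSS subn0 bV.
  by rewrite !mulgA.
- by have := Hg (R26_ba _); rewrite !wevalM !weval_letter !mulgA.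
- by move=> x y cx cy; rewrite mulgA cx -mulgA cy mulgA.
Qed.

Lemma c_eps i : i != ord0 -> c * eps i = eps i * c.
Proof.
move=> i0; have maxN0 : ord_max != ord0 :> leafT by rewrite -val_eqE /=; lia.
have ce : c * eps ord_max = eps ord_max * c.
  by rewrite eps_max; have := Hg (R23 _); rewrite !wevalM !weval_letter.
have p0 : tperm ord_max i ord0 = ord0 by rewrite tpermD.
rewrite -[i](tpermL ord_max) eps_perm tpermV mulgA c_stab // -mulgA (mulgA c) ce.
by rewrite -!mulgA c_stab.
Qed.

Lemma c_E l : ord0 \notin l -> c * E l = E l * c.
Proof.
elim: l => [|i l IHl] /=; first by rewrite mulg1 mul1g.
rewrite inE negb_or eq_sym => /andP[i0 /IHl cl].
by rewrite mulgA c_eps // -mulgA cl mulgA.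
Qed.

Lemma cz : c * z = E nonzero * d.
Proof.
by have := Hg (R20 _); rewrite expg2 !wevalM !weval_letter zzE.
Qed.

Lemma cE_nonzero : c * E nonzero = d * z.
Proof. by rewrite -zzE mulgA cz -d_E -mulgA E_nonzero_z. Qed.

Lemma zc : z * c = E all_leaves.
Proof.
have := Hg (R21 _); rewrite expg2 !wevalM !wevalX !weval_letter zzE !subSS subn0 bV => ->.
by rewrite E_cons E_comm_eps eps0E eps0_def !mulgA.
Qed.

(** Inserting [d] before the last [c] and moving it left turns the first [c] into
    [c * d = eps0 * d], so [eps0] may replace it. *)
Lemma c_swap0_c i : i != ord0 -> c * sg (swap0 i) * c = sg (swap0 i) * c * eps i.
Proof.
move=> i0; have [ec ed] := epsd_c.
rewrite -[LHS](_ : eps0 * sg (swap0 i) * c = _).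
  by rewrite -eps0E eps_sg tpermL -!mulgA c_eps.
by rewrite -dc !mulgA -[eps0 * _ * d]mulgA -d_sg mulgA ed -[c * d * _]mulgA d_sg -!mulgA (mulgA d) dc.
Qed.

(** [R18] and [R22] involve only the transposition of leaves 0 and 1; conjugating by the stabiliser
    of leaf 0 reaches the other [swap0 i]. *)
Lemma swap0J i : i != ord0 -> exists p : 'S_N.+1,
  [/\ p ord0 = ord0 & sg (swap0 i) = sg p^-1 * (sg (swap0 leaf1) * sg p)].
Proof.
move=> i0; exists (tperm leaf1 i); split; first by rewrite tpermD // leaf1N0.
rewrite -!sgM -/(swap0 leaf1 ^ _) tpermJ tpermL tpermD // leaf1N0 //.
Qed.

Lemma stabV (p : 'S_N.+1) : p ord0 = ord0 -> p^-1 ord0 = ord0.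
Proof. by move=> p0; rewrite -{1}p0 permK. Qed.

Lemma z_swap0_z i : i != ord0 -> z * sg (swap0 i) * z = E nonzero * d.
Proof.
case/swap0J => p [p0 ->]; rewrite -!mulgA (z_stab p0) mulgA (stab_z (stabV p0)).
have := Hg (R18 _); rewrite expg2 !wevalM !weval_letter a_swap0 zzE d_E => ->.
by rewrite mulgA.
Qed.

Lemma c_swap0_z i : i != ord0 ->
  c * sg (swap0 i) * z = sg (swap0 i) * c * sg (swap0 i) * E nonzero.
Proof.
case/swap0J => p [p0 ->]; have V0 := stabV p0.
rewrite -!mulgA (z_stab p0) mulgA (c_stab V0) -!mulgA (mulgA (sg p) c) -(c_stab p0).
rewrite -!mulgA sgK; congr (_ * _).
have := Hg (R22 _); rewrite expg2 !wevalM !weval_letter a_swap0 zzE -!mulgA => ->.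
do 3!congr (_ * _).
rewrite -[LHS](E_nonzero_sg p0) E_sg; congr (_ * _); apply: eq_E => j.
rewrite -[j](permKV p) mem_map; last exact: perm_inj.
by rewrite !mem_nonzero -{2}p0 (inj_eq perm_inj).
Qed.

(** The [swap0 j] represent the cosets of the stabiliser of leaf 0, which [z] absorbs on both sides
    and [c] commutes with. *)
Lemma sg_swap0_fix p : exists2 q : 'S_N.+1,
  q ord0 = ord0 & sg p = sg q * sg (swap0 (p ord0)).
Proof.
have [q [q0 ->]] := @sg_factor p ord0 (p ord0) erefl; exists q => //.
by rewrite !permM tpermL q0 tpermL swap00 mul1g sgM.
Qed.

Lemma sg_fix_swap0 p : exists2 q : 'S_N.+1,
  q ord0 = ord0 & sg p = sg (swap0 (p^-1 ord0)) * sg q.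
Proof.
have [q [q0 pE]] := @sg_factor p (p^-1 ord0) ord0 (permKV _ _); exists q => //.
by rewrite {1}pE swap00 mulg1 sgM.
Qed.

Lemma z_sg p : z * sg p = z * sg (swap0 (p ord0)).
Proof. by have [q q0 ->] := sg_swap0_fix p; rewrite mulgA (stab_z q0). Qed.

Lemma sg_z p : sg p * z = sg (swap0 (p^-1 ord0)) * z.
Proof. by have [q q0 ->] := sg_fix_swap0 p; rewrite -mulgA (z_stab q0). Qed.

(* In order: the centre is fixed; it is neither in the domain nor in the image;
   it is outside the domain and the image of the leaf [i]; it is sent to the leaf
   [j] and is the image of [i]; it is sent to [j] and nothing else is in the
   domain. *)
Inductive NF : M -> Prop :=
| NFfix l p : NF (E l * sg p)
| NFundef l p : NF (d * E l * sg p)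
| NFtocenter i l p : NF (sg (swap0 i) * c * E l * sg p)
| NFswap i j : NF (sg (swap0 i) * z * sg (swap0 j))
| NFcenter j : NF (z * d * sg (swap0 j)).

(** * Closure of the normal forms under multiplication *)

Lemma NF_sgr x p : NF x -> NF (x * sg p).
Proof.
case=> [l q|l q|i l q|i j|j]; rewrite -!mulgA -sgM ?mulgA; try by constructor.
  by rewrite -(mulgA _ z) z_sg mulgA; constructor.
by rewrite -mulgA d_sg mulgA z_sg -mulgA -d_sg mulgA; constructor.
Qed.

Lemma NF_sgl x p : NF x -> NF (sg p * x).
Proof.
case=> [l q|l q|i l q|i j|j].
- by rewrite mulgA sg_E -mulgA -sgM; constructor.
- by rewrite !mulgA -d_sg -(mulgA d) sg_E mulgA -(mulgA (_ * _)) -sgM; constructor.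
- rewrite !mulgA -sgM; have [r r0 ->] := sg_fix_swap0 (p * swap0 i).
  rewrite -(mulgA _ (sg r)) -(c_stab r0) mulgA -(mulgA _ (sg r)) sg_E mulgA.
  by rewrite -(mulgA (_ * _)) -sgM; constructor.
- by rewrite !mulgA -sgM sg_z; constructor.
- by rewrite mulgA sg_zd; constructor.
Qed.

Lemma NF_E l : NF (E l).
Proof. by rewrite -[E l]mulg1 -sg1; constructor. Qed.

Lemma NF_dE l : NF (d * E l).
Proof. by rewrite -[_ * _]mulg1 -sg1; constructor. Qed.

Lemma NF_cE l : NF (c * E l).
Proof.
by rewrite -[_ * _]mulg1 -sg1 -[c]mul1g -{1}sg1 -swap00; constructor.
Qed.

Lemma NF_z : NF z.
Proof. by rewrite -[z]mulg1 -[z]mul1g -sg1 -swap00; constructor. Qed.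

Lemma NF_zd : NF (z * d).
Proof. by rewrite -[_ * d]mulg1 -sg1 -swap00; constructor. Qed.

Lemma dzdE : d * z * d = d * E all_leaves.
Proof. by rewrite dzd d_E. Qed.

Lemma NF_eps x i : NF x -> NF (x * eps i).
Proof.
case=> [l p|l p|j l p|h j|j]; rewrite -mulgA sg_eps mulgA; apply: NF_sgr.
- by rewrite -E_comm_eps -E_cons; apply: NF_E.
- by rewrite -mulgA -E_comm_eps -E_cons; apply: NF_dE.
- by rewrite -!mulgA -E_comm_eps -E_cons; apply/NF_sgl/NF_cE.
- have [->|k0] := eqVneq ((swap0 j)^-1 i) ord0; rewrite -mulgA; apply: NF_sgl.
    (* Here [z * eps0 = d * z = c * E nonzero]: the centre leaves the domain while leaf 0 still goes
       to the centre. *)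
    by rewrite eps0E z_eps0 -cE_nonzero; apply: NF_cE.
  by rewrite z_eps //; apply: NF_z.
- rewrite -mulgA d_eps mulgA; have [->|k0] := eqVneq ((swap0 j)^-1 i) ord0.
    by rewrite eps0E z_eps0 dzdE; apply: NF_dE.
  by rewrite z_eps //; apply: NF_zd.
Qed.

Lemma NF_d x : NF x -> NF (x * d).
Proof.
case=> [l p|l p|j l p|h j|j]; rewrite -mulgA -d_sg mulgA; apply: NF_sgr.
- by rewrite -d_E; apply: NF_dE.
- by rewrite -mulgA -d_E mulgA rel6_d; apply: NF_dE.
- have [_ ed] := epsd_c.
  rewrite -!mulgA -d_E (mulgA c) -ed -eps0E -d_eps -mulgA -E_cons; exact/NF_sgl/NF_dE.
- by rewrite -mulgA; apply/NF_sgl/NF_zd.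
- by rewrite -mulgA rel6_d; apply: NF_zd.
Qed.

Lemma E_c l : ord0 \in l -> E l * c = E l * d.
Proof.
move=> l0; have [ec _] := epsd_c.
by rewrite -(eps_E l0) eps0E -eps0E E_comm_eps eps0E -!mulgA ec.
Qed.

Lemma sg_c p : exists2 q : 'S_N.+1, q ord0 = ord0 &
  sg p * c = sg (swap0 (p^-1 ord0)) * c * sg q.
Proof.
have [q q0 ->] := sg_fix_swap0 p; exists q => //.
by rewrite -!mulgA (c_stab q0).
Qed.

Lemma NF_Ec l : NF (E l * c).
Proof.
have [l0|l0] := boolP (ord0 \in l); first by rewrite E_c // -d_E; apply: NF_dE.
by rewrite -c_E //; apply: NF_cE.
Qed.

(** [swap0 i] brings an omitted nonzero leaf to position 0, and with leaf 0 omitted [c] acts as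
    [d]. *)
Lemma z_swap0_c i : i != ord0 -> z * sg (swap0 i) * c = z * d * sg (swap0 i).
Proof.
move=> i0; rewrite -{1}z_E_nonzero -(mulgA z) E_sg -!mulgA E_c.
  by rewrite (mulgA (sg _)) -E_sg -mulgA -d_sg (mulgA z) z_E_nonzero mulgA.
by apply/mapP; exists i; rewrite ?mem_nonzero // tpermR.
Qed.

Lemma NF_c x : NF x -> NF (x * c).
Proof.
have [ec ed] := epsd_c.
have Esc l p : NF (E l * sg p * c).
  rewrite -mulgA; have [q q0 ->] := sg_c p.
  rewrite !mulgA E_sg -(mulgA (sg _)); exact/NF_sgr/NF_sgl/NF_Ec.
case=> [l p|l p|j l p|h j|j] //.
- by rewrite d_E -(mulgA (E l)) d_sg -!mulgA dc mulgA.
- rewrite -!mulgA; apply: NF_sgl; have [q q0 ->] := sg_c p.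
  rewrite !mulgA; apply: NF_sgr; rewrite -(mulgA c) E_sg -!mulgA.
  set i := p^-1 ord0; set l' := map _ _.
  (* If leaf 0 is omitted before the second [c], that [c] acts as [d]; otherwise it moves left past
     [E l'] and meets the first one across [swap0 i]. *)
  have [l0|l0] := boolP (ord0 \in l').
    rewrite E_c // -d_E (mulgA _ d) -d_sg !mulgA -ed -eps0E -!mulgA sg_E.
    by rewrite !mulgA -d_eps -(mulgA d) -E_cons; apply/NF_sgr/NF_dE.
  rewrite -(c_E l0) !mulgA; have [->|i0] := eqVneq i ord0.
    rewrite swap00 sg1 mulg1; have <- : c * d = c * c.
      by have := Hg (R25_cd _); rewrite expg2 !wevalM !weval_letter.
    by rewrite -ed -eps0E -d_eps -mulgA -E_cons; apply: NF_dE.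
  by rewrite c_swap0_c // -!mulgA -E_cons; apply/NF_sgl/NF_cE.
- rewrite -!mulgA; apply: NF_sgl; have [->|j0] := eqVneq j ord0.
    by rewrite swap00 sg1 mul1g zc; apply: NF_E.
  by rewrite mulgA z_swap0_c //; apply/NF_sgr/NF_zd.
- rewrite -mulgA -mulgA (mulgA d) d_sg -mulgA dc; have [->|j0] := eqVneq j ord0.
    by rewrite swap00 sg1 mul1g zc; apply: NF_E.
  by rewrite mulgA z_swap0_c //; apply/NF_sgr/NF_zd.
Qed.

(** On the left [z] absorbs every [eps i] with [i] nonzero, so only the membership of leaf 0
    matters. *)
Lemma E_z l : E l * z = if ord0 \in l then z * d else z.
Proof.
rewrite -{1}E_nonzero_z mulgA -E_cat; case: ifP => l0.
  rewrite -E_all_z; congr (_ * _); apply: eq_E => i.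
  by rewrite mem_cat mem_all_leaves mem_nonzero; case: eqP => [->|]; rewrite ?l0 ?orbT.
rewrite -[RHS]E_nonzero_z; congr (_ * _); apply: eq_E => i; rewrite mem_cat.
by rewrite mem_nonzero; case: eqP => [->|]; rewrite ?l0 ?orbT.
Qed.

Lemma NF_mulz x : NF x -> NF (x * z).
Proof.
have Esz l p : NF (E l * sg p * z).
  rewrite -mulgA sg_z mulgA E_sg -mulgA; apply: NF_sgl.
  by rewrite E_z; case: ifP => _; [apply: NF_zd|apply: NF_z].
have zsz j : NF (z * sg (swap0 j) * z).
  have [->|j0] := eqVneq j ord0; first by rewrite swap00 sg1 mulg1 zzE; apply: NF_E.
  by rewrite z_swap0_z // -d_E; apply: NF_dE.
case=> [l p|l p|i l p|h j|j] //.
- rewrite d_E -(mulgA _ d) d_sg -!mulgA -z_eps0 -eps0E !mulgA.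
  exact: NF_eps.
- rewrite -!mulgA; apply: NF_sgl; rewrite sg_z (mulgA (E l)) E_sg -mulgA E_z.
  case: ifP => _; first by rewrite sg_zd mulgA cz -mulgA rel6_d -d_E; apply: NF_dE.
  have [->|i0] := eqVneq (p^-1 ord0) ord0.
    by rewrite swap00 sg1 mul1g cz -d_E; apply: NF_dE.
  by rewrite mulgA c_swap0_z // -!mulgA sg_E; apply/NF_sgl; rewrite mulgA; apply/NF_sgr/NF_cE.
- by rewrite -!mulgA; apply: NF_sgl; rewrite mulgA.
- by rewrite -mulgA -mulgA (mulgA d) d_sg -mulgA -z_eps0 -eps0E !mulgA; apply: NF_eps.
Qed.

(** [a] and [b] are values of [sg], and [e] is [eps ord_max], so the closure lemmas cover every
    letter. *)
Lemma NF_weval (w : word alphabet) : NF (weval g w).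
Proof.
elim/last_ind: w => [|w x IHw]; first exact: (NF_E [::]).
have -> : weval g (rcons w x) = weval g w * g x.
  rewrite -cats1 -[in RHS](weval_letter g x).
  exact: (wevalM g (w : word alphabet) (letter x)).
case: x; rewrite -?sga -?sgb -?eps_max.
- exact: NF_sgr.
- exact: NF_sgr.
- exact: NF_eps.
- exact: NF_c.
- exact: NF_d.
- exact: NF_mulz.
Qed.

(** * Action of the normal forms *)

Section Evaluation.

Variable phi : M -> iend (star N.+2).
Hypotheses (phi1 : phi 1 = 1) (phiM : {morph phi : x y / x * y}).
Hypothesis phig : forall x, phi (g x) = generator N.+2 x.

Definition act (x : M) (v : 'I_N.+2) : option 'I_N.+2 := iend_val (phi x) v.
Definition leaf (i : leafT) : 'I_N.+2 := lift ord0 i.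

Lemma leaf_inj : injective leaf.
Proof. exact: lift_inj. Qed.

Lemma val_leaf i : leaf i = i.+1 :> nat.
Proof. exact: lift0. Qed.

Lemma act1 v : act 1 v = Some v.
Proof. by rewrite /act phi1 ffunE. Qed.

Lemma actM x y v : act (x * y) v = obind (act y) (act x v).
Proof. by rewrite /act phiM ffunE. Qed.

Lemma act_g x v : act (g x) v = obind insub (nat_gen N.+2 x v).
Proof. by rewrite /act phig generatorE. Qed.

Lemma insub_leaf k : k <= N -> insub k.+1 = Some (leaf (inord k)).
Proof.
by move=> kN; rewrite -[k in LHS](inordK (kN : k < N.+1)) -val_leaf valK.
Qed.

Lemma act_gl x i : act (g x) (leaf i) = obind insub (nat_gen N.+2 x i.+1).
Proof. by rewrite act_g val_leaf. Qed.

Lemma insub_leafE i : insub i.+1 = Some (leaf i).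
Proof. by rewrite -val_leaf valK. Qed.

Lemma insub0 : insub 0 = Some (ord0 : 'I_N.+2).
Proof. by rewrite -[0]/(val (ord0 : 'I_N.+2)) valK. Qed.

Lemma act_sg p :
  act (sg p) ord0 = Some ord0 /\ forall i, act (sg p) (leaf i) = Some (leaf (p i)).
Proof.
apply: (shift_adj_ind (lo := 0) (q := cyc N) (P := fun p =>
  act (sg p) ord0 = Some ord0 /\ forall i, act (sg p) (leaf i) = Some (leaf (p i)))) => //.
- rewrite sga; split=> [|i]; rewrite ?act_gl ?act_g /=; first exact: insub0.
  rewrite -[in RHS](inord_val i) adjE; [|lia|by have := ltn_ord i; lia].
  rewrite -insub_leaf; last by have := ltn_ord i; do !case: eqP; lia.
  by congr insub; do !case: eqP; lia.
- rewrite sgb; split=> [|i]; rewrite ?act_gl ?act_g /=; first exact: insub0.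
  rewrite cycE -insub_leaf; last by have := ltn_ord i; do !case: eqP; lia.
  by congr insub; have := ltn_ord i; do !case: eqP; lia.
- by move=> i _; apply: cyc_inord.
- move=> q r [q0 q1] [r0 r1]; rewrite sgM; split=> [|i].
    by rewrite actM q0 /= r0.
  by rewrite actM q1 /= r1 permM.
- lia.
Qed.

Lemma act_sg0 p : act (sg p) ord0 = Some ord0.
Proof. by case: (act_sg p). Qed.

Lemma act_sgl p i : act (sg p) (leaf i) = Some (leaf (p i)).
Proof. by case: (act_sg p). Qed.

Lemma act_d0 : act d ord0 = None.
Proof. by rewrite act_g. Qed.

Lemma act_dl i : act d (leaf i) = Some (leaf i).
Proof. by rewrite act_gl /= insub_leafE. Qed.

Lemma act_c0 : act c ord0 = None.
Proof. by rewrite act_g. Qed.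

Lemma act_cl i : act c (leaf i) = Some (if i == ord0 then ord0 else leaf i).
Proof.
rewrite act_gl /= /fun_c /= eqSS -[i == ord0]val_eqE /=.
by case: eqP => _; rewrite /= ?insub0 // insub_leafE.
Qed.

Lemma act_z0 : act z ord0 = Some (leaf ord0).
Proof. by rewrite act_g /= insub_leaf // inord0. Qed.

Lemma act_zl i : act z (leaf i) = if i == ord0 then Some ord0 else None.
Proof.
rewrite act_gl /= /fun_z1 /= eqSS -[i == ord0]val_eqE /=.
by case: eqP => _; rewrite /= ?insub0.
Qed.

Lemma act_e0 : act e ord0 = Some ord0.
Proof. by rewrite act_g /= insub0. Qed.

Lemma act_el i : act e (leaf i) = if i == ord_max then None else Some (leaf i).
Proof.
rewrite act_gl /= /fun_e1 -[i == ord_max]val_eqE /= -insub_leafE.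
by have := ltn_ord i; case: ifP => ?; case: eqP => ? ? //=; lia.
Qed.

Lemma act_eps0 i : act (eps i) ord0 = Some ord0.
Proof.
rewrite -[i](tpermL ord_max) eps_perm eps_max !actM act_sg0 /= actM act_e0 /=.
exact: act_sg0.
Qed.

Lemma act_epsl i j : act (eps i) (leaf j) = if j == i then None else Some (leaf j).
Proof.
rewrite -{1}[i](tpermL ord_max) eps_perm eps_max tpermV actM act_sgl /= actM act_el.
rewrite -(inj_eq (@perm_inj _ (tperm ord_max i))) tpermK tpermL.
by case: ifP => //= _; rewrite act_sgl tpermK.
Qed.

Lemma act_E0 l : act (E l) ord0 = Some ord0.
Proof. by elim: l => [|i l IHl]; rewrite ?act1 // actM act_eps0. Qed.

Lemma act_El l j : act (E l) (leaf j) = if j \in l then None else Some (leaf j).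
Proof.
elim: l => [|i l IHl]; first exact: act1.
by rewrite actM act_epsl inE; case: eqP.
Qed.

Definition actE := (act_sg0, act_sgl, act_d0, act_dl, act_c0, act_cl,
  act_z0, act_zl, act_E0, act_El).

Lemma swap0_eq0 i j : (swap0 i j == ord0) = (j == i).
Proof. by rewrite -(inj_eq (@perm_inj _ (swap0 i))) tpermK tpermL. Qed.

Lemma swap0_eq i j : (swap0 i j == i) = (j == ord0).
Proof. by rewrite -(inj_eq (@perm_inj _ (swap0 i))) tpermK tpermR. Qed.

Lemma act_fix l p : act (E l * sg p) ord0 = Some ord0 /\
  forall j, act (E l * sg p) (leaf j) = if j \in l then None else Some (leaf (p j)).
Proof. by split=> [|j]; rewrite actM actE //=; [|case: ifP => //= _]; rewrite actE. Qed.

Lemma act_undef l p : act (d * E l * sg p) ord0 = None /\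
  forall j, act (d * E l * sg p) (leaf j) = if j \in l then None else Some (leaf (p j)).
Proof.
split=> [|j]; rewrite !actM actE //= actE; by case: ifP => //= _; rewrite actE.
Qed.

Lemma act_tocenter i l p : act (sg (swap0 i) * c * E l * sg p) ord0 = None /\
  forall j, act (sg (swap0 i) * c * E l * sg p) (leaf j) =
    if j == i then Some ord0
    else if swap0 i j \in l then None else Some (leaf (p (swap0 i j))).
Proof.
split=> [|j]; rewrite !actM !actE //= !actE //=.
rewrite swap0_eq0; case: eqP => _; rewrite actE /= ?actE //.
by case: ifP => //= _; rewrite actE.
Qed.

Lemma act_swap i j : act (sg (swap0 i) * z * sg (swap0 j)) ord0 = Some (leaf j) /\
  forall h, act (sg (swap0 i) * z * sg (swap0 j)) (leaf h) =
    if h == i then Some ord0 else None.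
Proof.
split=> [|h]; rewrite !actM !actE /= !actE /= ?actE ?tpermL //.
by rewrite swap0_eq0; case: eqP => _ //=; rewrite actE.
Qed.

Lemma act_center j : act (z * d * sg (swap0 j)) ord0 = Some (leaf j) /\
  forall h, act (z * d * sg (swap0 j)) (leaf h) = None.
Proof.
split=> [|h]; rewrite !actM !actE /= ?actE /= ?actE ?tpermL //.
by case: ifP => //= _; rewrite actE.
Qed.

Lemma leafN0 i : (leaf i == ord0) = false.
Proof. by []. Qed.

Lemma E_sg_inj l l' p p' :
  (forall j, (if j \in l then None else Some (leaf (p j))) =
             (if j \in l' then None else Some (leaf (p' j)))) ->
  E l * sg p = E l' * sg p'.
Proof.
move=> ll'; have e_l : l =i l'.
  by move=> j; have := ll' j; case: (j \in l); case: (j \in l').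
rewrite (eq_E e_l); apply: eq_E_sg => j jl'.
by have := ll' j; rewrite e_l (negPf jl') => /Some_inj/leaf_inj.
Qed.

(** The image of the centre, together with whether some leaf is sent to the centre, determines the
    shape; within a shape the parameters are compared leaf by leaf. *)
Lemma NF_inj x y : NF x -> NF y -> phi x = phi y -> x = y.
Proof.
move=> NFx NFy xy; have {xy} : act x =1 act y by move=> v; rewrite /act xy.
case: NFx => [l p|l p|i l p|i j|j]; case: NFy => [l' p'|l' p'|i' l' p'|i' j'|j'] A;
  have := A ord0; rewrite ?(act_fix _ _).1 ?(act_undef _ _).1 ?(act_tocenter _ _ _).1
    ?(act_swap _ _).1 ?(act_center _).1 //.
- by move=> _; apply: E_sg_inj => j; have := A (leaf j); rewrite !(act_fix _ _).2.
- move=> _; rewrite -!mulgA; congr (_ * _); apply: E_sg_inj => j.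
  by have := A (leaf j); rewrite !(act_undef _ _).2.
- have := A (leaf i'); rewrite (act_undef _ _).2 (act_tocenter _ _ _).2 eqxx.
  by case: ifP => // _ [].
- have := A (leaf i); rewrite (act_undef _ _).2 (act_tocenter _ _ _).2 eqxx.
  by case: ifP => // _ [].
- move=> _; have e_i : i = i'.
    have := A (leaf i); rewrite !(act_tocenter _ _ _).2 eqxx.
    by case: eqP => // _; case: ifP => // _ [].
  (* Leaf [i] goes to the centre, so the action does not see leaf 0 in [l] or [p]; writing [c] as
     [c * eps0] adds leaf 0 to both lists, and [E_sg_inj] applies. *)
  subst i'; rewrite -!mulgA; congr (_ * _); rewrite -c_eps0 -!mulgA; congr (_ * _).
  rewrite -eps0E !mulgA -!E_cons; apply: E_sg_inj => j; rewrite !inE.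
  have := A (leaf (swap0 i j)); rewrite !(act_tocenter _ _ _).2 tpermK.
  by rewrite swap0_eq; case: eqP.
- move=> /Some_inj/leaf_inj <-; have := A (leaf i); rewrite !(act_swap _ _).2 eqxx.
  by case: eqP => // ->.
- by have := A (leaf i); rewrite (act_swap _ _).2 (act_center _).2 eqxx.
- by have := A (leaf i'); rewrite (act_swap _ _).2 (act_center _).2 eqxx.
- by move=> /Some_inj/leaf_inj ->.
Qed.

Lemma phi_eq x (alpha : iend (star N.+2)) : act x ord0 = iend_val alpha ord0 ->
  (forall j, act x (leaf j) = iend_val alpha (leaf j)) -> phi x = alpha.
Proof.
move=> x0 xl; apply: val_inj; apply/ffunP => v.
by case: (unliftP ord0 v) => [i|] ->; [apply: xl|].
Qed.

Lemma phi_surj (alpha : iend (star N.+2)) : exists x, phi x = alpha.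
Proof.
have /is_iendP[inj endo] := iendP alpha.
(* A partial injection of the leaves extends to a permutation, and [l] lists the leaves outside its
   domain. *)
have key (f : leafT -> option leafT) : (forall i j k, f i = Some k -> f j = Some k -> i = j) ->
    exists (l : seq leafT) p, forall j, (if j \in l then None else Some (leaf (p j))) = omap leaf (f j).
  move=> /perm_extend[p pP]; exists [seq j <- enum 'I_N.+1 | f j == None], p => j.
  rewrite mem_filter mem_enum andbT; case E: (f j) => [k|] //=.
  by rewrite (pP _ _ E).
pose h j := obind (unlift ord0) (iend_val alpha (leaf j)).
have hE j k : h j = Some k -> iend_val alpha (leaf j) = Some (leaf k).
  by rewrite /h; case: (iend_val alpha (leaf j)) => //= v; case: unliftP => [k' ->|] // [->].
have h_inj i j k : h i = Some k -> h j = Some k -> i = j.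
  by move=> /hE hi /hE hj; apply/leaf_inj/(inj _ _ _ hi hj).
have h_leaf j : iend_val alpha (leaf j) <> Some ord0 ->
    omap leaf (h j) = iend_val alpha (leaf j).
  rewrite /h; case: (iend_val alpha (leaf j)) => //= v.
  by case: unliftP => [k ->|->].
case E0: (iend_val alpha ord0) => [v|].
  case: (unliftP ord0 v) E0 => [j ->|->] E0.
    have [/existsP[i]|/existsPn none] := boolP [exists i, iend_val alpha (leaf i) != None].
      case Ei: (iend_val alpha (leaf i)) => [w|] // _.
      (* The centre goes to leaf [j], so any leaf in the domain goes to a neighbour of that leaf,
         which can only be the centre; injectivity then allows at most one such leaf. *)
      have to0 k u : iend_val alpha (leaf k) = Some u -> u = ord0.
        move=> Ek; have := endo _ _ _ _ E0 Ek; rewrite /= /star_edge /= => /(_ isT).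
        by rewrite andbT => /eqP u0; apply: val_inj.
      exists (sg (swap0 i) * z * sg (swap0 j)).
      apply: phi_eq => [|k]; first by rewrite (act_swap _ _).1 E0.
      rewrite (act_swap _ _).2; case: eqP => [->|ki]; first by rewrite Ei (to0 _ _ Ei).
      case Ek: (iend_val alpha (leaf k)) => [u|] //; case: ki; apply: leaf_inj.
      by apply: (inj _ _ _ Ek); rewrite Ei (to0 _ _ Ei) (to0 _ _ Ek).
    exists (z * d * sg (swap0 j)).
    apply: phi_eq => [|k]; first by rewrite (act_center _).1 E0.
    by rewrite (act_center _).2; have := none k; rewrite negbK => /eqP.
  have [l [p lp]] := key h h_inj; exists (E l * sg p).
  apply: phi_eq => [|j]; first by rewrite (act_fix _ _).1 E0.
  rewrite (act_fix _ _).2 lp h_leaf // => Ej.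
  by have := inj _ _ _ E0 Ej; move/eqP; rewrite eq_sym leafN0.
have [/existsP[i /eqP Ei]|/existsPn none] :=
    boolP [exists i, iend_val alpha (leaf i) == Some ord0]; last first.
  have [l [p lp]] := key h h_inj; exists (d * E l * sg p).
  apply: phi_eq => [|j]; first by rewrite (act_undef _ _).1 E0.
  by rewrite (act_undef _ _).2 lp h_leaf //; apply/eqP/none.
(* The normal form starts with [swap0 i] and [c], so the leaf map is precomposed with [swap0 i] and
   made undefined at 0, the position taken by leaf [i]. *)
have [|l [p lp]] := key (fun j => if j == ord0 then None else h (swap0 i j)).
  by move=> j j' k; do 2!case: ifP => // _; move=> hj /(h_inj _ _ _ hj)/perm_inj.
exists (sg (swap0 i) * c * E l * sg p).
apply: phi_eq => [|j]; first by rewrite (act_tocenter _ _ _).1 E0.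
rewrite (act_tocenter _ _ _).2; case: eqP => [->|ji]; first by rewrite Ei.
rewrite lp swap0_eq0; case: eqP => // _; rewrite tpermK h_leaf // => Ej.
by case: ji; apply/leaf_inj/(inj _ _ _ Ej Ei).
Qed.

End Evaluation.

End StarRelations.

Theorem theorem7p5 (n : nat) (hn : 4 <= n) : defines (Rbar n) (generator n).
Proof.
case: n hn => [|[|N]] // N_gt1.
(* The abstract monoid [M] is now the quotient itself, with [g] giving the classes of the
   letters. *)
pose g x := wclass (Rbar N.+2) (letter x).
have wE (w : word alphabet) : weval g w = wclass (Rbar N.+2) w.
  elim: w => [|x w IHw] //; rewrite -[LHS]/(g x * weval g w) IHw.
  by rewrite -[_ * _]wclassM.
have Hg u v : Rbar N.+2 u v -> weval g u = weval g v.
  by move=> uv; rewrite !wE; apply/wclassP/cong_base.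
have HR u v : Rbar N.+2 u v ->
    weval (generator N.+2) u = weval (generator N.+2) v by apply: Rbar_generator.
have [sg [sg1 sgM sga sgb]] := moore_presentation N_gt1 (weval_moore N_gt1 Hg).
pose phi (x : quot_monoid (Rbar N.+2)) := weval (generator N.+2) (generic_quotient.repr x).
have phiE w : phi (wclass _ w) = weval (generator N.+2) w.
  by apply: (weval_cong HR); apply/wclassP; rewrite reprK_wclass.
have phi1 : phi 1 = 1 by apply: phiE.
have phiM : {morph phi : x y / x * y}.
  move=> x y; rewrite -[x]reprK_wclass -[y]reprK_wclass -[_ * _]wclassM.
  by rewrite !phiE wevalM.
have phig x : phi (g x) = generator N.+2 x by rewrite phiE weval_letter.
apply: definesP => // [y|u v].
  have [x <-] := phi_surj N_gt1 Hg sg1 sgM sga sgb phi1 phiM phig y.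
  by exists (generic_quotient.repr x).
rewrite -!phiE -!wE => uv; apply/wclassP; rewrite -!wE.
by apply: (NF_inj N_gt1 Hg sg1 sgM sga sgb phi1 phiM phig _ _ uv); apply: NF_weval.
Qed.
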